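(* Let $W$ be a complex vector space of dimension $m$ with a nondegenerate quadratic form. Let $\mu$ and $\nu$ be partitions of length at most $m/2-2$ if $m$ is even, and at most $(m-1)/2-1$ if $m$ is odd, such that the diagram of $\nu$ is obtained by adding one box $b$ to the diagram of $\mu$. Let $\phi: W\to\mathrm{Hom}(S_{[\mu]}W,S_{[\nu]}W)$, $v\mapsto\phi_v$, be the unique (up to scale) nonzero $SO(W)$-equivariant morphism. Let $v\in W$ be a non-isotropic vector. Then the morphism $\phi_v$ is never surjective, and it is not injective as long as the box $b$ does not belong to the first row.
   Context: For a partition $\lambda$ as in the claim, $S_{[\lambda]}W$ denotes the irreducible $SO(W)$-module defined as the subspace of the Schur module $S_\lambda W\subset W^{\otimes|\lambda|}$ which is the common kernel of all the contractions by the invariant quadratic form. *)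

(* Defs.v *)
From HB Require Import structures.
From mathcomp Require Import all_boot all_order all_fingroup all_algebra.
From mathcomp Require Import sesquilinear.
From mathcomp Require Import boolp reals complex.

Set Implicit Arguments.
Unset Strict Implicit.
Unset Printing Implicit Defensive.

Import GRing.Theory.
Local Open Scope ring_scope.

Definition is_partition (la : seq nat) : bool :=
  sorted geq la && (0%N \notin la).

(* Boxes are pairs (row, column), both counted from 0. *)
Definition in_diagram (la : seq nat) (c : nat * nat) : bool :=
  (c.2 < nth 0 la c.1)%N.

Definition adds_box (mu nu : seq nat) (b : nat * nat) : Prop :=
  ~~ in_diagram mu b /\
  forall c, in_diagram nu c = (c == b) || in_diagram mu c.

(* [size la <= m/2 - 2] for [m] even and [size la <= (m-1)/2 - 1] for [m] odd;
   additive because subtraction on [nat] is truncated. *)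
Definition length_bound (m : nat) (la : seq nat) : bool :=
  if odd m then (size la + 1 <= m.-1./2)%N else (size la + 2 <= m./2)%N.

Section Tensors.
Variables (F : fieldType) (W : vectType F).

Local Notation ix := 'I_(\dim {:W}).
Local Notation e := (fun a : ix => (vbasis {:W})`_a).
(* The tensor power of [W] with factors labelled by the finite type [I]; a
   tensor is given by its coordinates in the basis of pure tensors
   [e_(K i1) (x) e_(K i2) (x) ...], where [e := vbasis {:W}]. *)
Local Notation tpow I := {ffun {ffun I -> ix} -> F^o}.

Definition pure (I : finType) (w : I -> W) : tpow I :=
  [ffun K : {ffun I -> ix} => \prod_i coord (vbasis {:W}) (K i) (w i)].

(* For multilinear [f], the unique linear map sending [pure w] to [f w]; see
   [textend_pure]. *)
Definition textend (I : finType) (V : vectType F) (f : (I -> W) -> V)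
  (t : tpow I) : V := \sum_K (t K : F) *: f (fun i => e (K i)).

Definition tmap (I : finType) (g : 'End(W)) : tpow I -> tpow I :=
  textend (fun w => pure (fun i => g (w i))).

Definition tact (I : finType) (s : {perm I}) : tpow I -> tpow I :=
  textend (fun w => pure (fun i => w (s i))).

(* Meaningful for [i != j]; the remaining factors keep their labels. *)
Definition contract (B : {symmetric W}) (I : finType) (i j : I) :
    tpow I -> tpow {k : I | (k != i) && (k != j)} :=
  textend (fun w => B (w i) (w j) *: pure (fun k => w (val k))).

Fact textend_is_linear (I : finType) (V : vectType F) (f : (I -> W) -> V) : linear (textend f).
Proof.
move=> a x y; rewrite /textend scaler_sumr -big_split /=.
by apply: eq_bigr => K _; rewrite !ffunE scalerDl scalerA.
Qed.
HB.instance Definition _ (I : finType) (V : vectType F) (f : (I -> W) -> V) :=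
  GRing.isSemilinear.Build F (tpow I) V _ (textend f)
    (GRing.semilinear_linear (textend_is_linear f)).
HB.instance Definition _ (I : finType) g :=
  GRing.Linear.copy (@tmap I g) (textend (fun w => pure (fun i => g (w i)))).
HB.instance Definition _ (I : finType) s :=
  GRing.Linear.copy (@tact I s) (textend (fun w => pure (fun i => w (s i)))).
HB.instance Definition _ B (I : finType) i j :=
  GRing.Linear.copy (@contract B I i j)
    (textend (fun w => B (w i) (w j) *: pure (fun k => w (val k)))).

Definition upd (I : finType) (w : I -> W) (i : I) (x : W) : I -> W :=
  fun k => if k == i then x else w k.

Definition multilinear (I : finType) (V : vectType F) (f : (I -> W) -> V) :=
  forall w i, linear (fun x => f (upd w i x)).

Lemma updE (I : finType) (w : I -> W) i : upd w i (w i) = w.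
Proof. by apply: funext => k; rewrite /upd; case: eqP => // ->. Qed.

Lemma multilinear_eq (I : finType) (V : vectType F) (f h : (I -> W) -> V) :
  multilinear f -> multilinear h ->
  (forall K : {ffun I -> ix}, f (fun i => e (K i)) = h (fun i => e (K i))) ->
  f =1 h.
Proof.
move=> mf mh fh w.
suff gen (s : seq I) v : (forall i, i \notin s -> exists a : ix, v i = e a) ->
    f v = h v by apply: (gen (enum I)) => i; rewrite mem_enum.
elim: s v => [|i s IHs] v hv.
  have {}hv i : exists a : ix, v i == e a.
    by have [|a ->] := hv i; [|exists a].
  have -> : v = fun i => e ([ffun i => xchoose (hv i)] i).
    by apply: funext => i; rewrite ffunE; apply/eqP/(xchooseP (hv i)).
  exact: fh.
have lin_sum (q : (I -> W) -> V) : multilinear q ->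
    q v = \sum_a coord (vbasis {:W}) a (v i) *: q (upd v i (e a)).
  move=> mq; pose L : {linear W -> V} :=
    HB.pack (fun x => q (upd v i x)) (GRing.isSemilinear.Build F W V _
      (fun x => q (upd v i x)) (GRing.semilinear_linear (mq v i))).
  transitivity (L (v i)); first by rewrite /L /= updE.
  rewrite [v i in LHS](coord_vbasis (memvf _)) linear_sum.
  by apply: eq_bigr => a _; rewrite linearZ.
rewrite (lin_sum f mf) (lin_sum h mh); apply: eq_bigr => a _; congr (_ *: _).
apply: IHs => k ks; rewrite /upd; case: eqP => [_|/eqP ki]; first by exists a.
by apply: hv; rewrite inE negb_or ki.
Qed.

Lemma pureE (I : finType) (w : I -> W) (K : {ffun I -> ix}) :
  pure w K = \prod_i coord (vbasis {:W}) (K i) (w i) :> F.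
Proof. by rewrite ffunE. Qed.

Lemma pure_multilinear (I : finType) : multilinear (@pure I).
Proof.
move=> w i a x y; apply/ffunP => K.
have -> : (a *: pure (upd w i x) + pure (upd w i y)) K =
    a * (pure (upd w i x) K : F) + (pure (upd w i y) K : F) :> F.
  by rewrite ffunE; congr (_ + _); apply: ffunE.
have E z : pure (upd w i z) K = coord (vbasis {:W}) (K i) z *
    \prod_(k | k != i) coord (vbasis {:W}) (K k) (w k) :> F.
  rewrite pureE (bigD1 i) //= /upd eqxx; congr (_ * _).
  by apply: eq_bigr => k /negPf ->.
by rewrite !E linearP mulrDl mulrA.
Qed.

Lemma pure_basis (I : finType) (K J : {ffun I -> ix}) :
  pure (fun i => e (K i)) J = (J == K)%:R :> F.
Proof.
rewrite pureE; have [->|neq] := eqVneq J K.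
  rewrite big1 // => i _; rewrite coord_free ?eqxx //.
  exact: basis_free (vbasisP _).
have [i iK] : exists i, J i != K i.
  apply/existsP; rewrite -negb_forall; apply: contra neq => /forallP h.
  by apply/eqP/ffunP => i; apply/eqP.
rewrite (bigD1 i) //= coord_free; last exact: basis_free (vbasisP _).
by rewrite eq_sym (negPf iK) mul0r.
Qed.

Lemma textend_pure (I : finType) (V : vectType F) (f : (I -> W) -> V) w :
  multilinear f -> textend f (pure w) = f w.
Proof.
move=> mf; move: w; apply: multilinear_eq => //.
  by move=> w i a x y; rewrite pure_multilinear linearP.
move=> K; rewrite /textend (bigD1 K) //= pure_basis eqxx scale1r.
rewrite big1 ?addr0 // => J /negPf nJ.
by rewrite pure_basis nJ scale0r.
Qed.

Lemma pure_span (I : finType) (t : tpow I) : t = textend (@pure I) t.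
Proof.
apply/ffunP => J; rewrite /textend sum_ffunE (bigD1 J) //= ffunE pure_basis.
rewrite eqxx [_ *: _]mulr1 big1 ?addr0 // => K /negPf nK.
by rewrite ffunE pure_basis eq_sym nK [_ *: _]mulr0.
Qed.

Lemma pure_eq (I : finType) (V : vectType F) (L M : {linear tpow I -> V}) :
  (forall w, L (pure w) = M (pure w)) -> L =1 M.
Proof.
move=> LM t; rewrite [t]pure_span /textend !linear_sum.
by apply: eq_bigr => K _; rewrite !linearZ LM.
Qed.

Lemma tmap_pure (I : finType) (g : 'End(W)) (w : I -> W) :
  tmap g (pure w) = pure (fun i => g (w i)).
Proof.
rewrite /tmap textend_pure // => {}w i a x y.
have E z : (fun k => g (upd w i z k)) = upd (fun k => g (w k)) i (g z).
  by apply: funext => k; rewrite /upd; case: eqP.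
by rewrite !E linearP pure_multilinear.
Qed.

Lemma tact_pure (I : finType) (s : {perm I}) (w : I -> W) :
  tact s (pure w) = pure (fun i => w (s i)).
Proof.
rewrite /tact textend_pure // => {}w i a x y.
have E z : (fun k => upd w i z (s k)) = upd (fun k => w (s k)) (s^-1%g i) z.
  apply: funext => k; rewrite /upd; congr (if _ then _ else _).
  by apply/eqP/eqP => [<-|->]; rewrite ?permK ?permKV.
by rewrite !E pure_multilinear.
Qed.

Lemma contract_pure (B : {symmetric W}) (I : finType) (i j : I) (w : I -> W) :
  i != j ->
  contract B i j (pure w) = B (w i) (w j) *: pure (fun k => w (val k)).
Proof.
move=> ij; rewrite /contract textend_pure // => {}w l a x y.
have updN k z : k != l -> upd w l z k = w k by rewrite /upd => /negPf ->.
have updl z : upd w l z l = z by rewrite /upd eqxx.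
have drop z : ~~ ((l != i) && (l != j)) ->
    pure (fun k : {k : I | (k != i) && (k != j)} => upd w l z (val k)) =
    pure (fun k : {k : I | (k != i) && (k != j)} => w (val k)).
  move=> lij; congr pure; apply: funext => k; apply: updN.
  by apply: contraNneq lij => <-; exact: (valP k).
have [li|li] := eqVneq l i.
  rewrite !drop ?li ?eqxx // -li !updl !updN 1?eq_sym ?li //.
  by rewrite linearPl scalerDl scalerA.
have [lj|lj] := eqVneq l j.
  rewrite !drop ?lj ?eqxx ?andbF // -lj !updl !updN ?lj //.
  by rewrite linearPr scalerDl scalerA.
have lP : (l != i) && (l != j) by rewrite li lj.
have E z : (fun k : {k : I | (k != i) && (k != j)} => upd w l z (val k)) =
    upd (fun k => w (val k)) (exist _ l lP) z.
  by apply: funext => k; rewrite /upd -val_eqE.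
rewrite !E !updN 1?eq_sym // pure_multilinear scalerDr.
by rewrite !scalerA mulrC.
Qed.

(* Row by row numbering of the boxes: the box numbered [k] lies in row
   [reshape_index la k] and in column [reshape_offset la k]. *)
Definition row_group (la : seq nat) : {set {perm 'I_(sumn la)}} :=
  [set s : {perm 'I_(sumn la)} |
    [forall k, reshape_index la (s k) == reshape_index la k]].

Definition col_group (la : seq nat) : {set {perm 'I_(sumn la)}} :=
  [set s : {perm 'I_(sumn la)} |
    [forall k, reshape_offset la (s k) == reshape_offset la k]].

(* The Young symmetrizer, acting on the right: first symmetrize along the rows,
   then antisymmetrize along the columns. *)
Definition row_sym (la : seq nat) (t : tpow 'I_(sumn la)) : tpow 'I_(sumn la) :=
  \sum_(s in row_group la) tact s t.

Definition col_alt (la : seq nat) (t : tpow 'I_(sumn la)) : tpow 'I_(sumn la) :=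
  \sum_(s in col_group la) (-1) ^+ s *: tact s t.

Definition young_sym (la : seq nat) (t : tpow 'I_(sumn la)) :
  tpow 'I_(sumn la) := col_alt (row_sym t).

Fact young_sym_is_linear la : linear (@young_sym la).
Proof.
have lr : linear (@row_sym la).
  move=> a x y; rewrite /row_sym scaler_sumr -big_split.
  by apply: eq_bigr => s _; rewrite linearP.
have lc : linear (@col_alt la).
  move=> a x y; rewrite /col_alt scaler_sumr -big_split.
  by apply: eq_bigr => s _; rewrite linearP scalerDr !scalerA mulrC.
by move=> a x y; rewrite /young_sym lr lc.
Qed.
HB.instance Definition _ la :=
  GRing.isSemilinear.Build F (tpow 'I_(sumn la)) (tpow 'I_(sumn la)) _
    (@young_sym la) (GRing.semilinear_linear (@young_sym_is_linear la)).

Definition schur_module (la : seq nat) : {vspace tpow 'I_(sumn la)} :=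
  limg (linfun (@young_sym la)).

(* [B] is the polar form of the quadratic form [x |-> B x x]. *)
Variable B : {symmetric W}.

Definition so_module (la : seq nat) : {vspace tpow 'I_(sumn la)} :=
  (schur_module la :&:
   \bigcap_(p : 'I_(sumn la) * 'I_(sumn la) | p.1 != p.2)
     lker (linfun (contract B p.1 p.2)))%VS.

Definition in_SO (g : 'End(W)) : Prop :=
  (forall x y, B (g x) (g y) = B x y) /\
  \det (passmx.mxof (vbasis {:W}) (vbasis {:W}) g) = 1.

(* [tmap g] preserves [so_module la] for [g] in [SO(W)], see [tmap_so_module],
   so the projection [vsproj] only changes the type. *)
Definition so_act (la : seq nat) (g : 'End(W))
    (x : subvs_of (so_module la)) : subvs_of (so_module la) :=
  vsproj (so_module la) (tmap g (vsval x)).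

Lemma tmap_tact (I : finType) (g : 'End(W)) (s : {perm I}) (t : tpow I) :
  tmap g (tact s t) = tact s (tmap g t).
Proof.
apply: (@pure_eq I _ (tmap g \o tact s) (tact s \o tmap g)) => w /=.
by rewrite !(tact_pure, tmap_pure).
Qed.

Lemma tmap_contract (I : finType) (g : 'End(W)) (i j : I) (t : tpow I) : i != j ->
  (forall x y, B (g x) (g y) = B x y) ->
  contract B i j (tmap g t) = tmap g (contract B i j t).
Proof.
move=> ij gB.
apply: (@pure_eq I _ (contract B i j \o tmap g) (tmap g \o contract B i j)).
move=> w /=; rewrite tmap_pure !contract_pure // gB.
by rewrite linearZ /= tmap_pure.
Qed.

Lemma tmap_young_sym (la : seq nat) (g : 'End(W)) (t : tpow 'I_(sumn la)) :
  tmap g (young_sym t) = young_sym (tmap g t).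
Proof.
rewrite /young_sym /col_alt linear_sum; apply: eq_bigr => s _.
rewrite linearZ /= tmap_tact /row_sym; congr (_ *: tact s _).
by rewrite linear_sum; apply: eq_bigr => u _; apply: tmap_tact.
Qed.

Lemma tmap_so_module (la : seq nat) (g : 'End(W)) (t : tpow 'I_(sumn la)) :
  in_SO g -> t \in so_module la -> tmap g t \in so_module la.
Proof.
move=> [gB _] /memv_capP[/memv_imgP[u _ tE] ht].
apply/memv_capP; split.
  apply/memv_imgP; exists (tmap g u); first exact: memvf.
  by rewrite tE !lfunE tmap_young_sym.
rewrite memvE; apply/subv_bigcapP => p pP; rewrite -memvE memv_ker lfunE /=.
move: ht; rewrite memvE => /subv_bigcapP/(_ p pP).
rewrite -memvE memv_ker lfunE /= => /eqP ht.
by rewrite tmap_contract // ht linear0.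
Qed.

End Tensors.

(* [phi_(g w) = g o phi_w o g^-1], with [g] cleared on the right. *)
Definition SO_equivariant (F : fieldType) (W : vectType F) (B : {symmetric W})
    (mu nu : seq nat)
    (phi : 'Hom(W, 'Hom(subvs_of (so_module B mu), subvs_of (so_module B nu)))) :
    Prop :=
  forall g, in_SO B g -> forall w x,
    phi (g w) (so_act g x) = so_act g (phi w x).

(* Main.v *)
From HB Require Import structures.
Require Import Defs.
From mathcomp Require Import all_boot all_order all_fingroup all_algebra.
From mathcomp Require Import sesquilinear.
From mathcomp Require Import reals complex.
From mathcomp Require Import boolp ring lra zify.

(** Write [H] for the stabilizer of [v] in [SO(W)]; the map [phi v] is
   [H]-equivariant.

   Not surjective: [H] contains the scaling by [t] of an isotropic subspace of
   dimension [size nu] and by [1/t] of a dual one.  Its weights on tensors of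
   degree [|mu|] are at most [|mu|], while [S_[nu]] contains a highest weight
   vector built on that subspace, of weight [|nu| = |mu| + 1].

   Not injective: let [e_1, .., e_l] span an isotropic subspace of the
   orthogonal of [v], and let [x] in [S_[mu]] represent the linear form which
   evaluates a tensor at [v] in the boxes of the first row and at [e_i] in those
   of row [i].  Evaluate [phi v x] at an isotropic frame [b_0, .., b_l].  After
   subtracting multiples of [b_0] from the other [b_i], these are orthogonal to
   [v], and some element of [H] scales the [e_i] by [1/t] and these [b_i] by
   [t].  It multiplies [x] by [t ^ - N], where [N] is the number of boxes of [mu]
   below the first row.  As [nu] has [N + 1] such boxes, the value is [t] times a
   polynomial in [t]; it does not depend on [t], hence vanishes.

   It remains to see that an element [y] of [S_[nu]] which vanishes at generic
   isotropic frames is zero (this amounts to the irreducibility of [S_[nu]]).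
   Such elements form an [so(W)]-submodule; a highest weight vector in it has a
   weight [ell], and the Casimir element acts on it both by a scalar depending
   on [ell] and, since [y] is traceless and in the image of a Young symmetrizer,
   by the same scalar for [nu].  As [ell] is dominant and bounded by [nu] in the
   dominance order, [ell = nu], so the vector has a nonzero value at the standard
   frame, a contradiction. *)

Set Implicit Arguments.
Unset Strict Implicit.
Unset Printing Implicit Defensive.

Import Order.TTheory GRing.Theory Num.Theory.
Local Open Scope ring_scope.

(** * The action of so(W) on tensors in hyperbolic coordinates *)

Section CoordinateTensors.
Variables (m : nat) (I : finType).
Local Notation ix := {ffun I -> 'I_m}.

Definition upd_ix (K : ix) (i : I) (a : 'I_m) : ix :=
  [ffun j => if j == i then a else K j].

Lemma upd_ixE K i a j : upd_ix K i a j = if j == i then a else K j.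
Proof. by rewrite ffunE. Qed.

Lemma upd_ix_id K i a b : upd_ix (upd_ix K i a) i b = upd_ix K i b.
Proof. by apply/ffunP => j; rewrite !ffunE; case: eqP. Qed.

Lemma upd_ix_self K i : upd_ix K i (K i) = K.
Proof. by apply/ffunP => j; rewrite ffunE; case: eqP => [->|]. Qed.

Lemma upd_ixC K i j a b : i != j ->
  upd_ix (upd_ix K i a) j b = upd_ix (upd_ix K j b) i a.
Proof.
move=> ij; apply/ffunP => k; rewrite !ffunE.
by case: (eqVneq k j) => // ->; rewrite eq_sym (negPf ij).
Qed.

Lemma upd_ix_swap K i j : i != j ->
  upd_ix (upd_ix K i (K j)) j (K i) = [ffun k => K (tperm i j k)].
Proof.
move=> ij; apply/ffunP => k; rewrite !ffunE.
by case: tpermP => [->|->|/eqP/negPf-> /eqP/negPf->]//; rewrite eqxx ?(negPf ij).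
Qed.

Variable R : comNzRingType.
Local Notation tens := (ix -> R).

Lemma sum_pred1 (J : finType) (x : J) (g : J -> R) :
  \sum_y (x == y)%:R * g y = g x.
Proof.
rewrite (bigD1 x) //= eqxx mul1r big1 ?addr0 // => y /negPf.
by rewrite eq_sym => ->; rewrite mul0r.
Qed.

Lemma sum_pred1' (J : finType) (x : J) (g : J -> R) :
  \sum_y (y == x)%:R * g y = g x.
Proof. by rewrite -[RHS]sum_pred1; apply: eq_bigr => y _; rewrite eq_sym. Qed.

(* [T (.. w_b ..)] becomes [T (.. w_a ..)]: the derivation induced by the
   elementary matrix [E_ab] acts on covariant tensors, so that [gl_op] is an
   anti-homomorphism. *)
Definition gl_op (a b : 'I_m) (f : tens) : tens :=
  fun K => \sum_i (K i == b)%:R * f (upd_ix K i a).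

(** The part of a composite of two derivations in which they act on two different slots. It is
    symmetric in the two derivations, hence drops out of commutators. *)
Definition gl_op2 (a b c d : 'I_m) (f : tens) : tens := fun K =>
  \sum_i \sum_(j | j != i)
    (K i == b)%:R * (K j == d)%:R * f (upd_ix (upd_ix K i a) j c).

Lemma gl_op2C a b c d f K : gl_op2 a b c d f K = gl_op2 c d a b f K.
Proof.
rewrite /gl_op2 (exchange_big_dep predT) //=; apply: eq_bigr => j _.
apply: eq_big => [i|i ji]; first by rewrite eq_sym.
by rewrite upd_ixC 1?eq_sym // [_%:R * _%:R]mulrC.
Qed.

Lemma gl_op_comp a b c d f K :
  gl_op a b (gl_op c d f) K = (a == d)%:R * gl_op c b f K + gl_op2 a b c d f K.
Proof.
rewrite /gl_op /gl_op2 mulr_sumr -big_split; apply: eq_bigr => i _ /=.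
rewrite mulr_sumr (bigD1 i) //= upd_ix_id upd_ixE eqxx mulrCA; congr (_ + _).
apply: eq_bigr => j ji; rewrite upd_ixE (negPf ji) -!mulrA.
by rewrite upd_ixC // eq_sym.
Qed.

Lemma gl_opC a b c d f K :
  gl_op a b (gl_op c d f) K - gl_op c d (gl_op a b f) K =
  (a == d)%:R * gl_op c b f K - (c == b)%:R * gl_op a d f K.
Proof. rewrite !gl_op_comp gl_op2C; ring. Qed.

Lemma gl_op_lin a b c f g K :
  gl_op a b (fun L => c * f L + g L) K = c * gl_op a b f K + gl_op a b g K.
Proof.
rewrite /gl_op mulr_sumr -big_split; apply: eq_bigr => i _ /=.
by rewrite mulrDr mulrCA.
Qed.

Lemma gl_opB a b f g K :
  gl_op a b (fun L => f L - g L) K = gl_op a b f K - gl_op a b g K.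
Proof.
by rewrite /gl_op -sumrB; apply: eq_bigr => i _; rewrite mulrBr.
Qed.

Definition mult (K : ix) (a : 'I_m) : nat := #|[set i | K i == a]|.

Lemma multE K a : mult K a = (\sum_i (K i == a))%N.
Proof.
by rewrite /mult -sum1dep_card big_mkcond; apply: eq_bigr => i _; case: eqP.
Qed.

Lemma gl_op_diag a f K : gl_op a a f K = (mult K a)%:R * f K.
Proof.
rewrite /gl_op multE natr_sum mulr_suml.
apply: eq_bigr => i _; case: eqP => [<-|_]; last by rewrite !mul0r.
by rewrite upd_ix_self.
Qed.

Lemma sum_mult K : \sum_a (mult K a)%:R = #|I|%:R :> R.
Proof.
rewrite -natr_sum; congr (_%:R); rewrite -sum1_card.
rewrite (partition_big K predT) //=; apply: eq_bigr => a _.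
by rewrite /mult -sum1dep_card.
Qed.

(* The derivation induced by a matrix which is skew for the form pairing the basis
   vectors numbered [a] and [rev_ord a]. *)
Definition so_op (a b : 'I_m) (f : tens) : tens :=
  fun K => gl_op a b f K - gl_op (rev_ord b) (rev_ord a) f K.

Lemma so_op_lin a b c f g K :
  so_op a b (fun L => c * f L + g L) K = c * so_op a b f K + so_op a b g K.
Proof. rewrite /so_op !gl_op_lin; ring. Qed.

Lemma so_op_revN a b f K : so_op (rev_ord b) (rev_ord a) f K = - so_op a b f K.
Proof. by rewrite /so_op !rev_ordK opprB. Qed.

Lemma so_op_diag a f K :
  so_op a a f K = ((mult K a)%:R - (mult K (rev_ord a))%:R) * f K.
Proof. by rewrite /so_op !gl_op_diag mulrBl. Qed.

(** The [sl_2] relation for a pair of opposite root vectors; for [b = rev_ord a] the operator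
    [so_op a b] is zero. *)
Lemma so_op_comm a b f K : a != b -> b != rev_ord a ->
  so_op a b (so_op b a f) K - so_op b a (so_op a b f) K =
  so_op b b f K - so_op a a f K.
Proof.
move=> ab bra.
have H c d : so_op a b (so_op c d f) K - so_op c d (so_op a b f) K =
  (gl_op a b (gl_op c d f) K - gl_op c d (gl_op a b f) K)
  - (gl_op a b (gl_op (rev_ord d) (rev_ord c) f) K
     - gl_op (rev_ord d) (rev_ord c) (gl_op a b f) K)
  - (gl_op (rev_ord b) (rev_ord a) (gl_op c d f) K
     - gl_op c d (gl_op (rev_ord b) (rev_ord a) f) K)
  + (gl_op (rev_ord b) (rev_ord a) (gl_op (rev_ord d) (rev_ord c) f) K
     - gl_op (rev_ord d) (rev_ord c) (gl_op (rev_ord b) (rev_ord a) f) K).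
  by rewrite /so_op !gl_opB; ring.
have arb : a != rev_ord b.
  by apply: contraNneq bra => ->; rewrite rev_ordK.
rewrite H !gl_opC !eqxx (negPf arb) (negPf bra).
rewrite ![rev_ord _ == a]eq_sym ![rev_ord _ == b]eq_sym.
rewrite ?(negPf arb) ?(negPf bra) ?eqxx /so_op !mul1r !mul0r; ring.
Qed.

(** In hyperbolic coordinates the vectors numbered [c] and [rev_ord c] are dual to each other, so
    the sum is the contraction of the slots [i] and [j]. *)
Definition traceless (f : tens) : Prop := forall K i j, i != j ->
  \sum_c f (upd_ix (upd_ix K i c) j (rev_ord c)) = 0.

(** Derivations of the other slots commute with the contraction. On the slots [i] and [j] the two
    halves of [so_op] leave the same two terms, which cancel. *)
Lemma so_op_traceless a b f : traceless f -> traceless (so_op a b f).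
Proof.
move=> tf K i j ij; rewrite /so_op sumrB.
pose U c := upd_ix (upd_ix K i c) j (rev_ord c).
have Ui c d : upd_ix (U c) i d = upd_ix (upd_ix K i d) j (rev_ord c).
  by rewrite /U upd_ixC 1?eq_sym // upd_ix_id upd_ixC // eq_sym.
have Uj c d : upd_ix (U c) j d = upd_ix (upd_ix K i c) j d by rewrite /U upd_ix_id.
have gE x y : \sum_c gl_op x y f (U c) =
    f (upd_ix (upd_ix K i x) j (rev_ord y)) +
    f (upd_ix (upd_ix K i (rev_ord y)) j x).
  transitivity (\sum_k \sum_c (U c k == y)%:R * f (upd_ix (U c) k x)).
    by rewrite exchange_big.
  rewrite (bigD1 i) //= (bigD1 j) 1?eq_sym //= [X in _ + (_ + X)]big1 => [|k /andP[ki kj]].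
    rewrite addr0; congr (_ + _).
      under eq_bigr => c _.
        rewrite Ui !ffunE eqxx (negPf ij).
        over.
      by rewrite (sum_pred1' y (fun c => f (upd_ix (upd_ix K i x) j (rev_ord c)))).
    under eq_bigr => c _.
      rewrite Uj !ffunE eqxx.
      rewrite -[rev_ord c == y](inj_eq rev_ord_inj) rev_ordK.
      over.
    by rewrite (sum_pred1' (rev_ord y) (fun c => f (upd_ix (upd_ix K i c) j x))).
  under eq_bigr => c _.
    rewrite !ffunE (negPf ki) (negPf kj) upd_ixC 1?eq_sym //.
    rewrite (upd_ixC _ _ _ (_ : i != k)) 1?eq_sym //.
    over.
  by rewrite -mulr_sumr tf ?mulr0.
by rewrite !gE !rev_ordK; ring.
Qed.

Definition act_ix (s : {perm I}) (K : ix) : ix := [ffun k => K (s k)].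

Lemma gl_op_act a b f s K :
  gl_op a b f (act_ix s K) = gl_op a b (fun L => f (act_ix s L)) K.
Proof.
rewrite /gl_op (reindex_inj (@perm_inj _ s^-1)) /=; apply: eq_bigr => i _.
rewrite ffunE permKV; congr (_ * f _); apply/ffunP => k; rewrite !ffunE.
by rewrite -(inj_eq (@perm_inj _ s) k) permKV.
Qed.

Lemma so_op_act a b f s K :
  so_op a b f (act_ix s K) = so_op a b (fun L => f (act_ix s L)) K.
Proof. by rewrite /so_op !gl_op_act. Qed.

(** Ordered pairs are used, so this is twice the class sum of transpositions, through which the
    Casimir element acts on traceless tensors. *)
Definition swap_sum (f : tens) : tens :=
  fun K => \sum_i \sum_(j | j != i) f (act_ix (tperm i j) K).

Lemma so_op_swap_sum a b f K :
  swap_sum (so_op a b f) K = so_op a b (swap_sum f) K.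
Proof.
have gE x y : swap_sum (gl_op x y f) K = gl_op x y (swap_sum f) K.
  rewrite /swap_sum; under eq_bigr => i _ do under eq_bigr => j _ do rewrite gl_op_act.
  rewrite /gl_op; under eq_bigr => i _ do rewrite exchange_big /=.
  rewrite exchange_big /=; apply: eq_bigr => k _; rewrite mulr_sumr.
  by apply: eq_bigr => i _; rewrite mulr_sumr.
rewrite /so_op -!gE /swap_sum -sumrB; apply: eq_bigr => i _.
by rewrite -sumrB.
Qed.

(** The products [E_ab E_ba] sum to [m] times the degree plus the swaps. In the mixed products the
    terms on two distinct slots are contractions, hence vanish, and the terms on one slot give the
    degree. *)
Lemma casimir_traceless f K : traceless f ->
  \sum_a \sum_b so_op a b (so_op b a f) K =
  2%:R * ((m%:R - 1) * #|I|%:R * f K + swap_sum f K).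
Proof.
move=> tf.
have E a b : so_op a b (so_op b a f) K =
    gl_op a b (gl_op b a f) K - gl_op a b (gl_op (rev_ord a) (rev_ord b) f) K
  + (gl_op (rev_ord b) (rev_ord a) (gl_op (rev_ord a) (rev_ord b) f) K
     - gl_op (rev_ord b) (rev_ord a) (gl_op b a f) K).
  by rewrite /so_op !gl_opB; ring.
under eq_bigr => a _ do (under eq_bigr => b _ do rewrite E; rewrite big_split /=).
rewrite big_split /=.
(* Replacing [(a, b)] by [(rev_ord b, rev_ord a)] turns the second half of the expansion into the
   first. *)
have -> : \sum_a \sum_b (gl_op (rev_ord b) (rev_ord a) (gl_op (rev_ord a) (rev_ord b) f) K
     - gl_op (rev_ord b) (rev_ord a) (gl_op b a f) K) =
  \sum_a \sum_b (gl_op a b (gl_op b a f) K - gl_op a b (gl_op (rev_ord a) (rev_ord b) f) K).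
  rewrite exchange_big (reindex_inj rev_ord_inj); apply: eq_bigr => a _ /=.
  rewrite (reindex_inj rev_ord_inj); apply: eq_bigr => b _ /=.
  by rewrite !rev_ordK.
rewrite mulr_natl -mulr2n; congr (_ *+ 2).
under eq_bigr => a _ do rewrite sumrB.
rewrite sumrB.
have -> : \sum_a \sum_b gl_op a b (gl_op b a f) K = m%:R * #|I|%:R * f K + swap_sum f K.
  under eq_bigr => a _ do under eq_bigr => b _ do rewrite gl_op_comp eqxx mul1r gl_op_diag.
  under eq_bigr => a _ do rewrite big_split /= -mulr_suml sum_mult.
  rewrite big_split /= big_const_ord iter_addr_0.
  congr (_ + _); first by rewrite -[LHS]mulr_natl mulrA.
  rewrite /gl_op2 /swap_sum.
  under eq_bigr => a _ do rewrite exchange_big /=.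
  rewrite exchange_big /=; apply: eq_bigr => i _.
  under eq_bigr => a _ do rewrite exchange_big /=.
  rewrite exchange_big /=; apply: eq_bigr => j ji.
  under eq_bigr => a _.
    under eq_bigr => b _ do rewrite -mulrA.
    rewrite (sum_pred1 (K i) (fun b => (K j == a)%:R * f (upd_ix (upd_ix K i a) j b))).
    over.
  rewrite (sum_pred1 (K j) (fun a => f (upd_ix (upd_ix K i a) j (K i)))).
  by rewrite upd_ix_swap // eq_sym.
suff -> : \sum_a \sum_b gl_op a b (gl_op (rev_ord a) (rev_ord b) f) K = #|I|%:R * f K.
  by ring.
under eq_bigr => a _ do under eq_bigr => b _ do rewrite gl_op_comp.
under eq_bigr => a _ do rewrite big_split /=.
rewrite big_split /= [X in _ + X](_ : _ = 0) ?addr0; last first.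
  rewrite /gl_op2.
  under eq_bigr => a _ do rewrite exchange_big /=.
  rewrite exchange_big /= big1 // => i _.
  under eq_bigr => a _ do rewrite exchange_big /=.
  rewrite exchange_big /= big1 // => j ji.
  rewrite exchange_big /= big1 // => b _.
  by rewrite -mulr_sumr tf ?mulr0 // eq_sym.
rewrite exchange_big /=.
under eq_bigr => b _.
  rewrite (sum_pred1' (rev_ord b) (fun a => gl_op (rev_ord a) b f K)) rev_ordK gl_op_diag.
  over.
by rewrite -mulr_suml sum_mult.
Qed.

End CoordinateTensors.

(** * Highest weight vectors and the Casimir element *)

Section CasimirInequality.
Variables (m : nat) (nu ell : nat -> int).
Let n := m./2.
Let P j := \sum_(a < j) (nu a - ell a).
(** The product [(nu a - ell a) * g a] is the difference of the terms with index [a] in the two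
    Casimir values. *)
Let g a := nu a + ell a + (m%:Z - 2 - 2 * a%:Z).

(** Summation by parts; the inequality [g j - g j.+1 >= 2] produces the term with factor 2. *)
Let abel k : (k < n)%N -> (forall j, (j <= n)%N -> 0 <= P j) ->
  (forall a, (a.+1 < n)%N -> nu a.+1 <= nu a) ->
  (forall a, (a.+1 < n)%N -> ell a.+1 <= ell a) ->
  P k.+1 * g k + 2 * \sum_(j < k.+1) P j <= \sum_(a < k.+1) (nu a - ell a) * g a.
Proof.
move=> kn P0 nuD ellD; elim: k kn => [|k IHk] kn.
  by rewrite !big_ord_recr !big_ord0 /= /P !big_ord_recr !big_ord0 /=; lia.
have {IHk} := IHk (ltnW kn).
rewrite [\sum_(j < k.+2) P j]big_ord_recr [X in _ -> _ <= X]big_ord_recr /=.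
have PS : P k.+2 = P k.+1 + (nu k.+1 - ell k.+1) by rewrite /P big_ord_recr.
have gS : 0 <= g k - g k.+1 - 2.
  by rewrite /g; have := nuD k kn; have := ellD k kn; lia.
have := mulr_ge0 (P0 k.+1 (ltnW kn)) gS; rewrite PS.
move: (\sum_(a < k.+1) _) (\sum_(j < k.+1) _) (P k.+1) (g k) (g k.+1) => *.
nia.
Qed.

(* The difference of the two Casimir values is, by Abel summation, a combination
   of the partial sums [P j >= 0] with coefficients [g (j-1) - g j >= 2]; for [m]
   even the last weight may be negative and is handled apart. *)
Lemma casimir_rigid : (2 < m)%N ->
  (forall j, (j <= n)%N -> 0 <= P j) ->
  (~~ odd m -> 0 <= P n.-1 + ell n.-1) ->
  (forall a, (a.+1 < n)%N -> nu a.+1 <= nu a) ->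
  (forall a, 0 <= nu a) -> (~~ odd m -> nu n.-1 = 0) ->
  (forall a, (a.+1 < n)%N -> ell a.+1 <= ell a) ->
  (odd m -> 0 <= ell n.-1) ->
  (~~ odd m -> (1 < n)%N -> - ell n.-1 <= ell n.-2) ->
  \sum_(a < n) (nu a ^+ 2 + nu a * (m%:Z - 2 - 2 * a%:Z)) =
  \sum_(a < n) (ell a ^+ 2 + ell a * (m%:Z - 2 - 2 * a%:Z)) ->
  forall j, (j <= n)%N -> P j = 0.
Proof.
move=> m2 P0 Pm nuD nu0 nul ellD ello elle cas.
have mE : m = (odd m + n.*2)%N by rewrite odd_double_half.
have casg : \sum_(a < n) (nu a - ell a) * g a = 0.
  transitivity (\sum_(a < n) (nu a ^+ 2 + nu a * (m%:Z - 2 - 2 * a%:Z))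
     - \sum_(a < n) (ell a ^+ 2 + ell a * (m%:Z - 2 - 2 * a%:Z))).
    by rewrite -sumrB; apply: eq_bigr => a _; rewrite /g; ring.
  by rewrite cas subrr.
have zero k : (k < n)%N -> \sum_(j < k.+1) P j <= 0 ->
    forall j, (j <= k)%N -> P j = 0.
  move=> kn le0 j jk.
  have /eqP : \sum_(i < k.+1) P i = 0.
    apply/eqP; rewrite eq_le le0 sumr_ge0 // => i _; apply: P0.
    exact/ltnW/(leq_trans (ltn_ord i) kn).
  rewrite psumr_eq0 => [/allP/(_ (Ordinal (jk : (j < k.+1)%N)))|i _].
    by rewrite mem_index_enum => /(_ isT)/eqP.
  exact/P0/ltnW/(leq_trans (ltn_ord i) kn).
have sum0 k : (k < n)%N -> 0 <= \sum_(j < k.+1) P j.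
  move=> kn; apply: sumr_ge0 => i _; apply: P0.
  exact/ltnW/(leq_trans (ltn_ord i) kn).
case: (boolP (odd m)) mE ello Pm nul elle => om /= mE.
  move=> /(_ isT) ello _ _ _.
  have [k nE] : exists k, n = k.+1 by exists n.-1; lia.
  have kn : (k < n)%N by rewrite nE.
  have := abel kn P0 nuD ellD; move: (casg); rewrite nE => -> le0.
  have Pk := P0 k.+1 kn.
  (* For [m] odd the last coefficient is positive, so a sum of nonnegative terms is bounded by 0 and
     each of them vanishes. *)
  have gk : 1 <= g k.
    by rewrite /g; have := nu0 k; move: ello; rewrite nE /=; lia.
  have sk := sum0 k kn.
  have le0' : \sum_(j < k.+1) P j <= 0.
    move: le0 Pk gk sk; move: (\sum_(j < _) _) (P _) (g _) => *; nia.
  move=> j; rewrite leq_eqVlt => /predU1P[->|jk]; last exact: (zero k kn le0' j jk).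
  move: le0 Pk gk sk; move: (\sum_(j < _) _) (P _) (g _) => *; nia.
move=> _ /(_ isT) Pm /(_ isT) nul /(_ isT) elle.
have [k nE] : exists k, n = k.+2 by exists n.-2; lia.
have kn : (k < n)%N by rewrite nE.
have kn1 : (k.+1 < n)%N by rewrite nE.
have := abel kn P0 nuD ellD; move: casg.
rewrite nE big_ord_recr /=.
rewrite nE /= in Pm nul elle.
have Pn : 0 <= P k.+2 by apply: P0; rewrite nE.
have PS : P k.+2 = P k.+1 + (nu k.+1 - ell k.+1) by rewrite /P big_ord_recr.
(* For [m] even the last term of the Casimir difference is therefore [- ell k.+1 ^+ 2], and
   summation by parts is used only up to [k]. *)
have gS : g k.+1 = ell k.+1.
  rewrite /g nul add0r mE add0n -muln2 PoszM nE; lia.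
have gk : g k = nu k + ell k + 2.
  rewrite /g mE add0n -muln2 PoszM nE; lia.
have [a b c d e] : [/\ 0 <= P k.+1, 0 <= nu k, ell k.+1 <= ell k, - ell k.+1 <= ell k
  & 0 <= \sum_(j < k.+1) P j].
  by split; [exact: P0|exact: nu0|apply: ellD; rewrite nE|exact: elle|exact: sum0].
rewrite gS gk nul => e1 e2.
rewrite PS nul in Pn.
have [sum_le Pk1 ell0] : [/\ \sum_(j < k.+1) P j <= 0, P k.+1 = 0 & ell k.+1 = 0].
  have {}e2 : P k.+1 * (nu k + ell k + 2) + 2 * (\sum_(j < k.+1) P j) <= ell k.+1 ^+ 2.
    by move: e1 e2; move: (\sum_(a < _) _) (\sum_(j < k.+1) P j) (P k.+1) => *; nia.
  move: Pm Pn e2 a b c d e.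
  move: (\sum_(j < k.+1) P j) (P k.+1) (ell k.+1) (ell k) (nu k).
  move=> S p x y z px px' le a b c d e.
  (* As [|x| <= p] and [|x| <= y], the two products give [x ^+ 2 <= p * y]; the bound then leaves
     [p * z + 2 * p + 2 * S <= 0]. *)
  have h1 : 0 <= (p - x) * (y + x) by apply: mulr_ge0; lia.
  have h2 : 0 <= (p + x) * (y - x) by apply: mulr_ge0; lia.
  have h3 : 0 <= p * z by apply: mulr_ge0.
  have h4 : 2 * p + 2 * S <= 0 by nia.
  by split; lia.
move=> j; case: ltngtP => // [jk _|-> _]; last by rewrite PS Pk1 nul ell0.
move: jk; rewrite ltnS leq_eqVlt => /predU1P[->//|jk]; exact: (zero k kn sum_le j jk).
Qed.
End CasimirInequality.

(** * Diagrams and column-injective fillings *)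

Section Diagrams.
Variables (I : finType) (row col : I -> nat).

(** Boxes sit at distinct positions and columns are closed upwards. *)
Definition is_diagram : Prop :=
  (forall i j, row i = row j -> col i = col j -> i = j) /\
  (forall i r, (r < row i)%N -> exists j, row j = r /\ col j = col i).

Definition row_len (r : nat) : nat := #|[set i | row i == r]|.

Hypothesis dg : is_diagram.

Let rc_inj i j : row i = row j -> col i = col j -> i = j.
Proof. by case: dg => h _; apply: h. Qed.
Let rc_up i r : (r < row i)%N -> exists j, row j = r /\ col j = col i.
Proof. by case: dg => _; apply. Qed.

(** Moving each box one step up injects row [r.+1] into row [r]. *)
Lemma row_len_anti r : (row_len r.+1 <= row_len r)%N.
Proof.
pose up i := odflt i [pick j | (row j == r) && (col j == col i)].
have upP i : row i = r.+1 -> row (up i) = r /\ col (up i) = col i.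
  move=> ri; rewrite /up; case: pickP => [j /andP[/eqP -> /eqP ->]//|no].
  have [|j [rj cj]] := @rc_up i r; first by rewrite ri.
  by have := no j; rewrite rj cj !eqxx.
rewrite /row_len -(card_in_imset (f := up)) => [|i j].
  apply/subset_leq_card/subsetP => _ /imsetP[i + ->]; rewrite !inE => /eqP ri.
  by have [->] := upP i ri.
rewrite !inE => /eqP ri /eqP rj eij; apply: rc_inj; first by rewrite ri rj.
by rewrite -(proj2 (upP i ri)) eij (proj2 (upP j rj)).
Qed.

Lemma sum_row_len k : (\sum_(r < k) row_len r = #|[set i | (row i < k)%N]|)%N.
Proof.
elim: k => [|k IHk].
  by rewrite big_ord0; apply/esym/eqP; rewrite cards_eq0; apply/eqP/setP=> i; rewrite !inE.
rewrite big_ord_recr /= IHk /row_len -cardsUI.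
rewrite [X in (_ + X)%N](_ : _ = 0%N) ?addn0; last first.
  apply/eqP; rewrite cards_eq0; apply/eqP/setP => i; rewrite !inE.
  by case: eqP => [->|]; rewrite ?ltnn ?andbF.
by apply: eq_card => i; rewrite !inE ltnS [RHS]leq_eqVlt orbC.
Qed.

Lemma card_above i : #|[set j | (col j == col i) && (row j < row i)%N]| = row i.
Proof.
pose A := [set j | (col j == col i) && (row j < row i)%N].
pose rw (j : I) : 'I_(row i).+1 := inord (row j).
have rwE j : j \in A -> rw j = row j :> nat.
  by rewrite inE => /andP[_ lt]; rewrite inordK // ltnW.
rewrite -(card_in_imset (f := rw)) => [|j k jA kA /(congr1 val)]; last first.
  rewrite /= !rwE // => rjk; apply: rc_inj => //.
  by move: jA kA; rewrite !inE => /andP[/eqP -> _] /andP[/eqP -> _].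
have -> : rw @: A = [set~ ord_max].
  apply/setP => r; rewrite !inE; apply/imsetP/idP => [[j jA ->]|rm].
    by rewrite -val_eqE /= rwE //; move: jA; rewrite inE => /andP[_]; rewrite ltn_neqAle => /andP[].
  have rl : (r < row i)%N by rewrite ltn_neqAle -ltnS ltn_ord andbT.
  have [j [rj cj]] := rc_up rl.
  have jA : j \in A by rewrite inE rj cj eqxx.
  by exists j => //; apply: val_inj; rewrite /= rwE.
by rewrite cardsC1 card_ord.
Qed.

(** If the column has more than [size S] boxes, the right side is [size S], which bounds the left
    one by injectivity; otherwise the right side counts every box of the column. *)
Lemma col_card_le (X : eqType) (K : I -> X) (S : seq X) c :
  (forall i j, col i = col j -> K i = K j -> i = j) ->
  (#|[set i | (col i == c) && (K i \in S)]| <=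
   #|[set i | (col i == c) && (row i < size S)%N]|)%N.
Proof.
move=> Kinj.
case: (boolP [exists i, (col i == c) && (size S <= row i)%N]) => [/existsP[i0 /andP[/eqP ci0 ri0]]|].
  have -> : #|[set i | (col i == c) && (row i < size S)%N]| = size S.
    pose rw (j : I) : 'I_(size S).+1 := inord (row j).
    rewrite -(card_in_imset (f := rw)) => [|j k]; last first.
      rewrite !inE => /andP[/eqP cj rj] /andP[/eqP ck rk] /(congr1 val).
      rewrite /= !inordK ?ltnS 1?ltnW // => rjk; apply: rc_inj => //.
      by rewrite cj ck.
    rewrite (_ : rw @: _ = [set~ ord_max]) ?cardsC1 ?card_ord //.
    apply/setP => r; rewrite !inE; apply/imsetP/idP => [[j]|rm].
      rewrite inE => /andP[_ rj] ->.
      by rewrite -val_eqE /= inordK ?ltnS 1?ltnW //; move: rj; rewrite ltn_neqAle => /andP[].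
    have rl : (r < size S)%N by rewrite ltn_neqAle -ltnS ltn_ord andbT.
    have [j [rj cj]] := rc_up (leq_trans rl ri0).
    exists j; first by rewrite inE rj cj ci0 eqxx.
    apply: val_inj; rewrite /= /rw rj inordK //.
  pose A := [set i | (col i == c) && (K i \in S)].
  have Ku : uniq [seq K i | i <- enum A].
    rewrite map_inj_in_uniq ?enum_uniq // => i j.
    rewrite !mem_enum !inE => /andP[/eqP ci _] /andP[/eqP cj _].
    by apply: Kinj; rewrite ci cj.
  rewrite cardE -(size_map K); apply: uniq_leq_size => // _ /mapP[i + ->].
  by rewrite mem_enum inE => /andP[].
rewrite negb_exists => /forallP no; apply/subset_leq_card/subsetP => i.
rewrite !inE => /andP[ci _]; rewrite ci /= ltnNge.
by have := no i; rewrite ci.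
Qed.

Lemma card_cols (A : pred I) :
  #|[set i | A i]| =
  (\sum_(c < (\max_i col i).+1) #|[set i | (col i == c) && A i]|)%N.
Proof.
rewrite -sum1_card (partition_big (fun i => inord (col i) : 'I_(\max_i col i).+1) predT) //=.
apply: eq_bigr => c _; rewrite -sum1_card; apply: eq_bigl => i; rewrite !inE andbC.
congr andb; rewrite -val_eqE /= inordK // ltnS; exact: leq_bigmax.
Qed.

(** Summed over the columns, this is the dominance bound of the content of a filling by its shape.
    Allowing any list [S] of values serves the case of even [m]. *)
Lemma strict_card_le (X : eqType) (K : I -> X) (S : seq X) :
  (forall i j, col i = col j -> K i = K j -> i = j) ->
  (#|[set i | K i \in S]| <= #|[set i | (row i < size S)%N]|)%N.
Proof.
by move=> Kinj; rewrite !card_cols; apply: leq_sum => c _; apply: col_card_le.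
Qed.

(** Equality in the total forces equality in every column, so each column contains exactly the
    values that are its row indices, and a column permutation sorts it. *)
Lemma strict_card_eq k (K : I -> nat) :
  (forall i j, col i = col j -> K i = K j -> i = j) ->
  (forall i, (row i < k)%N) ->
  (forall j, (j <= k)%N ->
    #|[set i | (K i < j)%N]| = #|[set i | (row i < j)%N]|) ->
  exists s : {perm I}, forall i, col (s i) = col i /\ K (s i) = row i.
Proof.
move=> Kinj rk Kcard.
have colE c j : (j <= k)%N -> #|[set i | (col i == c) && (K i < j)%N]| =
    #|[set i | (col i == c) && (row i < j)%N]|.
  move=> jk; have le c' : (#|[set i | (col i == c') && (K i < j)%N]| <=
      #|[set i | (col i == c') && (row i < j)%N]|)%N.
    have := @col_card_le _ K (iota 0 j) c' Kinj; rewrite size_iota.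
    by under eq_finset => i do rewrite mem_iota add0n leq0n andTb.
  have [cm|cm] := ltnP c (\max_i col i).+1; last first.
    have no B : #|[set i | (col i == c) && B i]| = 0%N.
      apply/eqP; rewrite cards_eq0; apply/eqP/setP => i; rewrite !inE.
      apply/negbTE; rewrite negb_and; apply/orP; left.
      by rewrite neq_ltn (leq_trans _ cm) // ltnS leq_bigmax.
    by rewrite !no.
  have := Kcard j jk; rewrite card_cols [RHS]card_cols => /eqP.
  have := @leqif_sum 'I_(\max_i col i).+1 predT _ _ _ (fun c' _ => leqif_eq (le (val c'))).
  by move=> [_ ->] /forallP/(_ (Ordinal cm))/eqP.
have ex i : exists j, (col j == col i) && (K j == row i).
  have := colE (col i) (row i).+1 (rk i); have := colE (col i) (row i) (ltnW (rk i)).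
  move=> e1 e2.
  case: (boolP [exists j, (col j == col i) && (K j == row i)]) => [/existsP//|].
  rewrite negb_exists => /forallP no; exfalso.
  have : [set j | (col j == col i) && (K j < (row i).+1)%N] =
         [set j | (col j == col i) && (K j < row i)%N].
    apply/setP => j; rewrite !inE ltnS leq_eqVlt.
    by have := no j; case: eqP => //= _ /negPf ->.
  move=> e3; move: e2; rewrite e3 e1 => e4.
  have : [set j | (col j == col i) && (row j < row i)%N] \proper
      [set j | (col j == col i) && (row j < (row i).+1)%N].
    apply/properP; split; first by apply/subsetP => j; rewrite !inE => /andP[-> /ltnW].
    by exists i; rewrite !inE eqxx ?ltnS ?leqnn ?ltnn.
  by move/proper_card; rewrite e4 ltnn.
pose f i := xchoose (ex i).
have fP i : col (f i) = col i /\ K (f i) = row i.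
  by have /andP[/eqP ? /eqP ?] := xchooseP (ex i).
have finj : injective f.
  move=> i j fij; apply: rc_inj.
    by rewrite -(proj2 (fP i)) fij (proj2 (fP j)).
  by rewrite -(proj1 (fP i)) fij (proj1 (fP j)).
by exists (perm finj) => i; rewrite permE.
Qed.

End Diagrams.

(** * Existence of highest weight vectors *)

Section HighestWeight.
Variables (F : numClosedFieldType) (m : nat) (I : finType).
Local Notation ix := {ffun I -> 'I_m}.
Local Notation tens := (ix -> F).

(** For the standard Hermitian form, transposed elementary matrices are adjoint: interchanging the
    values [a] and [b] in slot [i] matches the two sums. *)
Lemma gl_op_adj a b (f g : tens) :
  \sum_K gl_op a b f K * (g K)^* = \sum_K f K * (gl_op b a g K)^*.
Proof.
rewrite /gl_op; under eq_bigr => K _ do rewrite mulr_suml.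
under [RHS]eq_bigr => K _ do rewrite raddf_sum mulr_sumr.
rewrite exchange_big [RHS]exchange_big; apply: eq_bigr => i _ /=.
pose sw (K : ix) := upd_ix K i (tperm a b (K i)).
have swK : involutive sw.
  by move=> K; rewrite /sw upd_ix_id upd_ixE eqxx tpermK upd_ix_self.
rewrite (reindex_inj (inv_inj swK)); apply: eq_bigr => K _ /=.
rewrite /sw upd_ixE eqxx upd_ix_id rmorphM /= conjC_nat.
rewrite (can2_eq (tpermK a b) (tpermK a b)) tpermR.
by case: eqP => [<-|_]; rewrite ?mul0r ?mulr0 // tpermL !mul1r upd_ix_self.
Qed.

Lemma so_op_adj a b (f g : tens) :
  \sum_K so_op a b f K * (g K)^* = \sum_K f K * (so_op b a g K)^*.
Proof.
rewrite /so_op; under eq_bigr do rewrite mulrBl.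
under [RHS]eq_bigr do rewrite rmorphB mulrBr.
by rewrite !sumrB !gl_op_adj.
Qed.

Definition weight (K : ix) (a : 'I_m) : int := (mult K a)%:Z - (mult K (rev_ord a))%:Z.

Lemma so_op_weight a (f : tens) K : so_op a a f K = (weight K a)%:~R * f K.
Proof. by rewrite so_op_diag /weight rmorphB. Qed.

Definition depth (K : ix) : nat := \sum_i K i.

(** Makes the depth a function of the weight, hence constant on the support of a weight vector. *)
Lemma depth_weight K :
  (m%:Z - 1) * #|I|%:Z - 2 * (depth K)%:Z =
  \sum_(a < m | (a < rev_ord a)%N) weight K a * (m%:Z - 1 - 2 * a%:Z).
Proof.
have -> : (m%:Z - 1) * #|I|%:Z - 2 * (depth K)%:Z =
    \sum_a (mult K a)%:Z * (m%:Z - 1 - 2 * a%:Z).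
  rewrite -[#|I|%:Z]intz -pmulrn -(sum_mult int K) mulr_sumr /depth.
  have -> : (\sum_i K i = \sum_a mult K a * a)%N.
    rewrite (partition_big K predT) //=; apply: eq_bigr => a _.
    rewrite multE big_distrl /= [RHS](bigID (fun i => K i == a)) /=.
    rewrite [X in _ = (_ + X)%N]big1 ?addn0 => [|i /negPf -> //].
    by apply: eq_bigr => i /eqP ->; rewrite eqxx mul1n.
  rewrite -[X in _ - _ * X]intz -pmulrn natr_sum mulr_sumr -sumrB.
  by apply: eq_bigr => a _; rewrite natrM !pmulrn !intz; ring.
rewrite (bigID (fun a : 'I_m => (a < rev_ord a)%N)) /=.
have -> : \sum_(a < m | ~~ (a < m - a.+1)%N) (mult K a)%:Z * (m%:Z - 1 - 2 * a%:Z) =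
   \sum_(a < m | (a < m - a.+1)%N) (mult K (rev_ord a))%:Z * - (m%:Z - 1 - 2 * a%:Z).
  rewrite (reindex_inj rev_ord_inj) /= big_mkcond [RHS]big_mkcond /=.
  apply: eq_bigr => a _; have := ltn_ord a => am.
  case: ifP; case: ifP => //; try lia.
  by move=> h1 h2; rewrite (_ : _ - _ - _ = 0) ?mulr0 //; lia.
by rewrite -big_split; apply: eq_bigr => a _; rewrite /weight /=; ring.
Qed.

Variables (row col : I -> nat).

Definition col_alternating (f : tens) : Prop :=
  forall s : {perm I}, (forall i, col (s i) = col i) ->
  forall K, f (act_ix s K) = (-1) ^+ s * f K.

Lemma col_alternating_inj f K i j : col_alternating f ->
  f K != 0 -> col i = col j -> K i = K j -> i = j.
Proof.
move=> fa fK cij Kij; apply/eqP/negPn/negP => ij; move/negP: fK; apply.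
have := fa (tperm i j) _ K.
have -> : act_ix (tperm i j) K = K.
  by apply/ffunP => k; rewrite ffunE; case: tpermP => [->|->|].
move=> /(_ _)/eqP; rewrite odd_tperm ij expr1 mulN1r -addr_eq0 -mulr2n mulrn_eq0 /=.
by apply=> k; case: tpermP => [->|->|].
Qed.

Definition pair_count (r : I -> nat) : F :=
  \sum_i \sum_(j | j != i) (r i == r j)%:R.

(* The eigenvalue is twice the sum of the contents of the boxes. *)
Definition young_eigen (f : tens) : Prop :=
  forall K, swap_sum f K = (pair_count row - pair_count col) * f K.

(** [Y] plays the role of an [so(W)]-submodule: it is assumed stable under the root operators, and
    [Yso_diag] adds the diagonal ones. *)
Variable Y : tens -> Prop.
Hypothesis m3 : (2 < m)%N.
Hypothesis Ylin : forall c f g, Y f -> Y g -> Y (fun K => c * f K + g K).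
Hypothesis Yso : forall a b f, a != b -> b != rev_ord a -> Y f -> Y (so_op a b f).

Lemma Yscale c f : Y f -> Y (fun K => c * f K).
Proof.
move=> Yf; have := Ylin (c - 1) Yf Yf.
by congr Y; apply: funext => K; ring.
Qed.

(** With [b] different from [a] and [rev_ord a], which exists as [m > 2], the commutators for the
    pairs [(a, b)] and [(a, rev_ord b)] add up to [- 2] times [so_op a a]. *)
Lemma Yso_diag a f : Y f -> Y (so_op a a f).
Proof.
move=> Yf.
have [b ba bra] : exists2 b : 'I_m, b != a & b != rev_ord a.
  have [am|am] := boolP ((a == 0%N :> nat) || (a == m.-1 :> nat)).
    have m1 : (1 < m)%N by lia.
    by exists (Ordinal m1); rewrite -val_eqE /=; lia.
  have m0 : (0 < m)%N by lia.
  by exists (Ordinal m0); rewrite -val_eqE /=; have := ltn_ord a; lia.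
have ab : a != b by rewrite eq_sym.
have arb : a != rev_ord b by apply: contraNneq bra => ->; rewrite rev_ordK.
have rbra : rev_ord b != rev_ord a by rewrite (inj_eq rev_ord_inj).
have bb : b != rev_ord a := bra.
have Y1 := Yso ab bra (Yso ba arb Yf).
have Y2 := Yso ba arb (Yso ab bra Yf).
have rba : rev_ord b != a by rewrite eq_sym.
have arbb : a != rev_ord (rev_ord b) by rewrite rev_ordK.
have Y3 := Yso arb rbra (Yso rba arbb Yf).
have Y4 := Yso rba arbb (Yso arb rbra Yf).
have := Yscale (- 2%:R^-1) (Ylin 1 Y1 (Ylin (-1) Y2 (Ylin 1 Y3 (Ylin (-1) Y4 (Yscale 0 Yf))))).
congr Y; apply: funext => K /=.
have := so_op_comm f K ab bra; have := so_op_comm f K arb rbra.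
rewrite so_op_revN.
move: (so_op a b (so_op b a f) K) (so_op b a (so_op a b f) K)
  (so_op a _ (so_op _ a f) K) (so_op _ a (so_op a _ f) K)
  (so_op a a f K) (so_op b b f K) => x y z t u v.
move=> e1 e2.
transitivity (- 2%:R^-1 * ((x - y) + (z - t))); first by ring.
by rewrite e1 e2; field.
Qed.

(** The product of the operators [so_op a a - p], over the values [p] that occur as weights other
    than that of [K0], kills all the other weight spaces. *)
Lemma weight_projection f K0 : Y f -> f K0 != 0 ->
  exists2 g, Y g & g K0 != 0 /\ forall K, g K != 0 -> weight K =1 weight K0.
Proof.
move=> Yf fK0.
have proj (s : seq ('I_m * int)) : Y (fun K =>
    (\prod_(p <- s) ((weight K p.1)%:~R - p.2%:~R)) * f K).
  elim: s => [|[a p] s IHs].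
    by congr Y: (Yf); apply: funext => K; rewrite big_nil mul1r.
  have := Ylin (-1) (Yscale p%:~R IHs) (Yso_diag a IHs).
  congr Y; apply: funext => K; rewrite so_op_weight big_cons /=; ring.
pose s := [seq (q.1, weight q.2 q.1) | q <- enum {: 'I_m * ix} & weight q.2 q.1 != weight K0 q.1].
exists (fun K => (\prod_(p <- s) ((weight K p.1)%:~R - p.2%:~R)) * f K); first exact: proj.
split.
  rewrite mulf_neq0 // prodf_seq_neq0; apply/allP => p /mapP[q].
  rewrite mem_filter => /andP[nq _] -> /=.
  by rewrite subr_eq0 eqr_int eq_sym.
move=> K; rewrite mulf_eq0 negb_or prodf_seq_neq0 => /andP[/allP pr _] a.
apply/eqP/negPn/negP => na.
have /pr /= : (a, weight K a) \in s.
  by apply/mapP; exists (a, K); rewrite // mem_filter na mem_enum.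
by rewrite subrr eqxx.
Qed.

(** Take [K0] of least depth among the indices at which some member of [Y] is nonzero, and project
    to its weight. A raising operator that does not kill the result would give a member of [Y]
    nonzero at a smaller depth. *)
Lemma highest_weight f : Y f -> (exists K, f K != 0) ->
  exists g K0, [/\ Y g, g K0 != 0, forall K, g K != 0 -> weight K =1 weight K0
    & forall (a b : 'I_m) K, (b < a)%N -> so_op a b g K = 0].
Proof.
move=> Yf [K fK].
pose P K := `[< exists2 f, Y f & f K != 0 >].
have PK : P K by apply/asboolP; exists f.
case: (arg_minnP depth PK) => K0 /asboolP[f0 Yf0 f0K0] Kmin.
have [g Yg [gK0 gw]] := weight_projection Yf0 f0K0.
exists g, K0; split=> // a b L ba.
have gdepth M : g M != 0 -> depth M = depth K0.
  move=> /gw wM; suff : (m%:Z - 1) * #|I|%:Z - 2 * (depth M)%:Z =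
      (m%:Z - 1) * #|I|%:Z - 2 * (depth K0)%:Z by lia.
  by rewrite !depth_weight; apply: eq_bigr => c _; rewrite wM.
have [bra|bra] := eqVneq b (rev_ord a).
  by rewrite bra /so_op rev_ordK subrr.
apply/eqP/negPn/negP => nz.
have := Kmin L; have -> : P L.
  apply/asboolP; exists (so_op a b g) => //; apply: Yso => //.
  by rewrite -val_eqE /= gtn_eqF.
move=> /(_ isT); apply/negP; rewrite -ltnNge.
have up i (c : 'I_m) : (L i < c)%N -> g (upd_ix L i c) != 0 -> (depth L < depth K0)%N.
  move=> Lc /gdepth <-; rewrite /depth (bigD1 i) //= [X in (_ < X)%N](bigD1 i) //=.
  rewrite upd_ixE eqxx; under [X in (_ < _ + X)%N]eq_bigr => j /negPf ji do rewrite upd_ixE ji.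
  by rewrite ltn_add2r.
have zero (c d : 'I_m) : (d < c)%N -> gl_op c d g L != 0 -> (depth L < depth K0)%N.
  move=> dc; apply: contraR => dL; apply/eqP/big1 => i _.
  have [Ld|] := eqVneq (L i) d; last by rewrite mul0r.
  rewrite mul1r; apply/eqP; apply: contraR dL; apply: up; by rewrite Ld.
have [z|/(zero _ _ ba)//] := eqVneq (gl_op a b g L) 0.
move: nz; rewrite /so_op z sub0r oppr_eq0; apply: zero => /=.
by have := ltn_ord a; lia.
Qed.

End HighestWeight.

(** * Pairs of boxes in a common row or column *)

Section PairCounts.
Variables (F : numClosedFieldType) (I : finType) (row col : I -> nat).
Hypothesis dg : is_diagram row col.

Lemma sum_by_row (V : nmodType) n (h : nat -> V) : (forall i, (row i < n)%N) ->
  \sum_i h (row i) = \sum_(r < n) h r *+ row_len row r.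
Proof.
move=> rn; rewrite (partition_big (fun i => Ordinal (rn i)) predT) //=.
apply: eq_bigr => r _; rewrite (eq_bigr (fun=> h r)) => [|i /eqP <- //].
by rewrite sumr_const; congr (_ *+ _); apply: eq_card => i; rewrite inE.
Qed.

Lemma pair_count_row n : (forall i, (row i < n)%N) ->
  pair_count F row =
  \sum_(r < n) ((row_len row r)%:R ^+ 2 - (row_len row r)%:R).
Proof.
move=> rn; rewrite /pair_count.
transitivity (\sum_i ((row_len row (row i))%:R - 1 : F)).
  apply: eq_bigr => i _; rewrite /row_len -sum1dep_card natr_sum.
  rewrite [in RHS](bigD1 i) //= [1 + _]addrC addrK big_mkcond [RHS]big_mkcond /=.
  by apply: eq_bigr => j _; rewrite [row i == _]eq_sym andbC; do 2!case: eqP.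
rewrite (sum_by_row (fun r => (row_len row r)%:R - 1) rn).
by apply: eq_bigr => r _; rewrite -mulr_natr; ring.
Qed.

(** Each pair in a column is counted at its lower box, which has [r] boxes above it when it lies in
    row [r]; the two orders of the pair give the factor 2. *)
Lemma pair_count_col n : (forall i, (row i < n)%N) ->
  pair_count F col = \sum_(r < n) 2%:R * r%:R * (row_len row r)%:R.
Proof.
move=> rn; rewrite /pair_count.
pose A i j : F := ((col j == col i) && (row j < row i)%N)%:R.
transitivity (\sum_i \sum_j (A i j + A j i)).
  apply: eq_bigr => i _; rewrite [RHS](bigD1 i) //= /A ltnn andbF !add0r.
  apply: eq_bigr => j ji; rewrite [col j == _]eq_sym.
  have [cij|] := eqVneq (col i) (col j); last by rewrite addr0.
  have : row i != row j.
    by apply: contraNneq ji => rij; apply/eqP; case: dg => inj _; exact: inj.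
  by case: ltngtP; rewrite ?addr0 ?add0r.
under eq_bigr do rewrite big_split /=.
rewrite big_split /= [X in _ + X]exchange_big /=.
have -> : \sum_i \sum_j A i j = \sum_i (row i)%:R.
  apply: eq_bigr => i _; rewrite -[in RHS](card_above dg i) -sum1dep_card natr_sum.
  by rewrite [RHS]big_mkcond; apply: eq_bigr => j _; rewrite /A; case: ifP.
rewrite (sum_by_row (fun r => r%:R : F) rn) -[LHS]mulr2n -[LHS]mulr_natl mulr_sumr.
by apply: eq_bigr => r _; rewrite -[_ *+ row_len _ _]mulr_natr mulrA.
Qed.

End PairCounts.

Lemma sum_rev_half (m : nat) (h : nat -> int) :
  (forall a, (a < m)%N -> h (m - a.+1)%N = h a) -> (odd m -> h m./2 = 0) ->
  \sum_(a < m) h a = 2 * \sum_(a < m./2) h a.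
Proof.
move=> hr ho; rewrite -(big_mkord predT h) (@big_cat_nat _ _ _ m./2) //=; last by lia.
rewrite [X in X + _]big_mkord [2 * _]mulr_natl mulr2n; congr (_ + _).
have -> : \sum_(m./2 <= a < m) h a = \sum_(uphalf m <= a < m) h a.
  case: (boolP (odd m)) => om; last by congr (\sum_(_ <= a < m) h a); rewrite uphalf_half (negPf om).
  have lt : (m./2 < m)%N by lia.
  by rewrite big_ltn // ho // add0r uphalf_half om.
rewrite big_nat_rev /= -{1}[uphalf m]add0n big_addn.
rewrite (_ : (m - uphalf m = m./2)%N) ?big_mkord; last by rewrite uphalf_half; lia.
apply: eq_bigr => a _; have := ltn_ord a => am.
have {}am : (a < m)%N by lia.
rewrite -[RHS]hr //; congr h; lia.
Qed.

(** * Comparison of the highest weight with the shape *)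

Section HwVanish.
Variables (F : numClosedFieldType) (m : nat) (I : finType) (row col : I -> nat).
Local Notation ix := {ffun I -> 'I_m}.
Local Notation tens := (ix -> F).
Hypothesis dg : is_diagram row col.
Variable l : nat.
Hypothesis rl : forall i, (row i < l)%N.
(** Thus [l <= m./2], and for even [m] the last of the [m./2] possible rows is empty. *)
Hypothesis lm : (l < uphalf m)%N.
Hypothesis m3 : (2 < m)%N.

Section HighestVector.
Variables (g : tens) (K0 : ix).
Hypothesis gK0 : g K0 != 0.
Hypothesis gw : forall K, g K != 0 -> weight K =1 weight K0.
Hypothesis ghw : forall (a b : 'I_m) K, (b < a)%N -> so_op a b g K = 0.
Hypothesis galt : col_alternating col g.
Hypothesis gtr : traceless g.
Hypothesis gye : young_eigen row col g.

Let w a := weight K0 a.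

Lemma hw_diag a K : so_op a a g K = (w a)%:~R * g K.
Proof.
rewrite so_op_weight /w; have [->|/gw ->//] := eqVneq (g K) 0.
by rewrite !mulr0.
Qed.

Lemma so_op_zero a b (f : tens) K : (forall L, f L = 0) -> so_op a b f K = 0.
Proof.
by move=> f0; rewrite /so_op /gl_op !big1 ?subrr // => i _; rewrite f0 mulr0.
Qed.

Lemma hw_lower (a b : 'I_m) K : (b < a)%N -> b != rev_ord a ->
  so_op a b (so_op b a g) K = (w b - w a)%:~R * g K.
Proof.
move=> ba bra; have ab : a != b by rewrite -val_eqE /= gtn_eqF.
have := so_op_comm g K ab bra.
rewrite [X in _ - X]so_op_zero => [|L]; last exact: ghw.
by rewrite subr0 !hw_diag => ->; rewrite [X in _ = X * _]intrB mulrBl.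
Qed.

(* The squared norm of [so_op b a g] is [w b - w a] times that of [g], as [so_op a b] is
   the adjoint of [so_op b a]. *)
Lemma hw_dominant (a b : 'I_m) : (b < a)%N -> b != rev_ord a -> w a <= w b.
Proof.
move=> ba bra; rewrite -subr_ge0.
have := so_op_adj b a g (so_op b a g).
under [X in _ = X -> _]eq_bigr do rewrite hw_lower // rmorphM /= rmorph_int mulrCA.
rewrite -mulr_sumr => e.
have pos : 0 < \sum_K g K * (g K)^*.
  rewrite (bigD1 K0) //= ltr_pwDl ?mul_conjC_gt0 // sumr_ge0 // => K _.
  exact: mul_conjC_ge0.
rewrite -(ler0z F) -(pmulr_lge0 _ pos) -e sumr_ge0 // => K _.
exact: mul_conjC_ge0.
Qed.

(** For [a < b] the inner operator is a raising one and kills [g]; the diagonal terms give squares,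
    and [hw_lower] evaluates the others. *)
Lemma hw_casimir :
  \sum_a \sum_b so_op a b (so_op b a g) K0 =
  (\sum_a (w a ^+ 2 + \sum_(b < m | (b < a)%N && (b != rev_ord a)) (w b - w a)))%:~R
  * g K0.
Proof.
rewrite rmorph_sum mulr_suml; apply: eq_bigr => a _ /=.
rewrite [in RHS]intrD mulrDl (bigD1 a) //=; congr (_ + _).
  by rewrite so_op_weight hw_diag -/(w a) mulrA -intrM.
rewrite rmorph_sum /= mulr_suml big_mkcond [RHS]big_mkcond /=.
apply: eq_bigr => b _; have [->|ba] := eqVneq b a; first by rewrite ltnn.
have [lt|] := ltnP (nat_of_ord b) (nat_of_ord a) => /=; last first.
  move=> ab; rewrite so_op_zero // => L; apply: ghw.
  by rewrite ltn_neqAle ab andbT eq_sym.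
have [bra|bra] /= := eqVneq b (rev_ord a); last exact: hw_lower.
by rewrite bra {1}/so_op rev_ordK subrr.
Qed.

Let cnt (a : nat) : nat := #|[set i | K0 i == a :> nat]|.
Let ell (a : nat) : int := (cnt a)%:Z - (cnt (m - a.+1))%:Z.
Let nu (a : nat) : int := (row_len row a)%:Z.
Let n := m./2.

Let wE (a : 'I_m) : w a = ell a.
Proof. by []. Qed.

(** The differences regroup to the coefficient [m - 1 - 2 a] of [w a], and leaving out
    [b = rev_ord a] shifts it by one towards 0. Both factors of the resulting products are odd under
    reversal of the indices, so the two halves of the sum agree. *)
Let cas_ell : \sum_a (w a ^+ 2 + \sum_(b < m | (b < a)%N && (b != rev_ord a)) (w b - w a)) =
  2 * \sum_(a < n) (ell a ^+ 2 + ell a * (m%:Z - 2 - 2 * a%:Z)).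
Proof.
pose h a : int := ell a ^+ 2 + ell a *
  (m%:Z - 1 - 2 * a%:Z + (m - a.+1 < a)%N%:Z - (a < m - a.+1)%N%:Z).
have ell_rev a : (a < m)%N -> ell (m - a.+1)%N = - ell a.
  by move=> am; rewrite /ell (_ : (m - (m - a.+1).+1 = a)%N) ?opprB; lia.
transitivity (\sum_(a < m) h a); last first.
  rewrite sum_rev_half => [|a am|om].
  - congr (2 * _); apply: eq_bigr => a _; have := ltn_ord a => an.
    have {}an : (a < m - a.+1)%N by rewrite /n in an; lia.
    rewrite /h an ltnNge (ltnW an) /=; congr (_ + _ * _). ring.
  - rewrite /h ell_rev // sqrrN mulNr -mulrN; congr (_ + _ * _).
    rewrite (_ : (m - (m - a.+1).+1 = a)%N); lia.
  - by have -> : h m./2 = 0; rewrite // /h (_ : ell m./2 = 0) ?mul0r ?expr0n //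
      /ell (_ : (m - m./2.+1 = m./2)%N) ?subrr //; lia.
rewrite big_split [RHS]big_split /=; congr (_ + _).
have -> : \sum_(a < m) \sum_(b < m | (b < a)%N && (b != rev_ord a)) (w b - w a) =
    \sum_(a < m) (\sum_(b < m | (b < a)%N) (w b - w a)
      - (rev_ord a < a)%N%:Z * (w (rev_ord a) - w a)).
  apply: eq_bigr => a _; have [lt|ge] := ltnP (rev_ord a) a.
    rewrite [in RHS](bigD1 (rev_ord a)) //= mul1r.
    set S := \sum_(i < m | _) _; set S' := (X in _ = _ + X - _).
    by rewrite (_ : S = S') ?[w _ - _ + _]addrC ?addrK.
  rewrite mul0r subr0; apply: eq_bigl => b; apply: andb_idr => ba.
  by apply: contraTneq ba => ->; rewrite -leqNgt.
rewrite sumrB.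
have -> : \sum_(a < m) \sum_(b < m | (b < a)%N) (w b - w a) =
    \sum_(a < m) w a * (m%:Z - 1 - 2 * a%:Z).
  under eq_bigr do rewrite sumrB.
  rewrite sumrB (exchange_big_dep predT) //= -sumrB; apply: eq_bigr => a _.
  have lt k : (k <= m)%N -> \sum_(b < m | (b < k)%N) w a = w a * k%:Z.
    move=> km; rewrite (big_ord_narrow km) sumr_const card_ord.
    by rewrite -mulr_natr pmulrn intz.
  have := lt m (leqnn m); rewrite (bigID (fun b : 'I_m => (b < a.+1)%N)) /=.
  under eq_bigl => b do rewrite ltn_ord.
  rewrite lt // [X in _ + X](_ : _ = \sum_(b < m | (a < b)%N) w a); last first.
    by apply: eq_bigl => b; rewrite ltn_ord ltnS -ltnNge.
  rewrite (lt a) ?(ltnW (ltn_ord a)) // => e.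
  have {}e : \sum_(b < m | (a < b)%N) w a = w a * m%:Z - w a * a.+1%:Z by rewrite -e; ring.
  by rewrite e -addn1 PoszD; ring.
have -> : \sum_(a < m) (rev_ord a < a)%N%:Z * (w (rev_ord a) - w a) =
    - \sum_(a < m) w a * ((rev_ord a < a)%N%:Z - (a < rev_ord a)%N%:Z).
  under eq_bigr do rewrite mulrBr.
  rewrite sumrB (reindex_inj rev_ord_inj) /= -sumrB -sumrN.
  apply: eq_bigr => a _; rewrite !wE (_ : (m - (m - a.+1).+1)%N = a).
    by rewrite [rev_ord (rev_ord a)]rev_ordK; ring.
  by have := ltn_ord a; lia.
rewrite opprK -big_split; apply: eq_bigr => a _; rewrite wE /=; ring.
Qed.

Let ln : (l <= n)%N.
Proof. by move: lm; rewrite uphalf_half /n; lia. Qed.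

Let rn i : (row i < n)%N.
Proof. exact: leq_trans (rl i) ln. Qed.

(** Both sides are half the Casimir eigenvalue of [g], computed on the left from tracelessness and
    the Young symmetrizer, on the right from the highest weight. *)
Let cas_nu : \sum_(a < n) (nu a ^+ 2 + nu a * (m%:Z - 2 - 2 * a%:Z)) =
  \sum_(a < n) (ell a ^+ 2 + ell a * (m%:Z - 2 - 2 * a%:Z)).
Proof.
have := casimir_traceless K0 gtr; rewrite hw_casimir cas_ell gye.
rewrite (pair_count_row F rn) (pair_count_col F dg rn) -mulrDl mulrA => /(mulIf gK0).
rewrite intrM => /mulfI e; apply/eqP; rewrite -(eqr_int F); apply/eqP/esym.
rewrite {}e ?pnatr_eq0 // -sumrB.
have -> : #|I|%:R = \sum_(a < n) (row_len row a)%:R :> F.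
  rewrite -natr_sum sum_row_len; congr (_%:R); apply: eq_card => i.
  by rewrite !inE rn.
rewrite mulr_sumr -big_split rmorph_sum; apply: eq_bigr => a _ /=.
rewrite /nu -[a%:Z]intz !(intrD, intrM, intrB, rmorphN, rmorphXn) /= -!pmulrn; ring.
Qed.

Let Kinj i j : col i = col j -> K0 i = K0 j -> i = j.
Proof. exact: col_alternating_inj galt gK0. Qed.

Let Kinj_nat i j : col i = col j -> K0 i = K0 j :> nat -> i = j.
Proof. by move=> cij /val_inj; apply: Kinj. Qed.

Let cnt_sum j : (\sum_(a < j) cnt a)%N = #|[set i | (K0 i < j)%N]|.
Proof. exact: (sum_row_len (fun i => K0 i)). Qed.

Let cnt_le j : (\sum_(a < j) cnt a <= \sum_(a < j) row_len row a)%N.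
Proof.
rewrite cnt_sum sum_row_len.
have := strict_card_le dg (iota 0 j) Kinj_nat; rewrite size_iota.
by under eq_finset => i do rewrite mem_iota add0n leq0n andTb.
Qed.

Let ell_le j : \sum_(a < j) ell a <= (\sum_(a < j) cnt a)%:Z.
Proof.
rewrite -natz natr_sum; apply: ler_sum => a _; rewrite natz /ell; lia.
Qed.

Let nu_sum j : \sum_(a < j) nu a = (\sum_(a < j) row_len row a)%:Z.
Proof. by rewrite -natz natr_sum; apply: eq_bigr => a _; rewrite natz. Qed.

Let ell_dom (a b : nat) : (b < a < m)%N -> (a + b).+1 != m -> ell a <= ell b.
Proof.
move=> /andP[ba am] ab; have bm : (b < m)%N by apply: ltn_trans am.
apply: (@hw_dominant (Ordinal am) (Ordinal bm)) => //.
by rewrite -val_eqE /=; apply: contraNneq ab => ->; apply/eqP; lia.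
Qed.

Let partial_sums j : (j <= n)%N -> \sum_(a < j) (nu a - ell a) = 0.
Proof.
have mE : m = (odd m + n.*2)%N by rewrite odd_double_half.
have nul : ~~ odd m -> nu n.-1 = 0.
  move=> om; rewrite /nu /row_len; congr Posz.
  apply/eqP; rewrite cards_eq0; apply/eqP/setP => i; rewrite !inE.
  apply/negbTE; have := rl i; have : (l <= n.-1)%N; last lia.
  by move: lm; rewrite uphalf_half (negPf om) add0n -/n; lia.
move: j; apply: (@casimir_rigid m nu ell) => //.
- move=> k kn; rewrite sumrB nu_sum subr_ge0; apply: le_trans (ell_le k) _.
  by rewrite lez_nat cnt_le.
- move=> om.
  have [k nE] : exists k, n = k.+1 by exists n.-1; lia.
  rewrite -/n nE /= sumrB nu_sum.
  have ek : ell k = (cnt k)%:Z - (cnt n)%:Z.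
    by rewrite /ell; congr (_ - (cnt _)%:Z); lia.
  suff : (\sum_(a < k) cnt a + cnt n <= \sum_(a < k) row_len row a)%N.
    have := ell_le k; rewrite ek.
    move: (\sum_(a < k) ell a) (\sum_(a < k) cnt a)%N
      (\sum_(a < k) row_len row a)%N (cnt k) (cnt n); clear; lia.
  have -> : (\sum_(a < k) row_len row a = #|[set i | (row i < k.+1)%N]|)%N.
    rewrite -sum_row_len big_ord_recr /=; have := nul om.
    by rewrite nE /nu /= => -[->]; rewrite addn0.
  (* The dominance bound is applied to the values [0, .., n - 2, n], skipping [n - 1]: the counts of
     [n - 1] and [n] enter [ell n.-1] with opposite signs. *)
  have := strict_card_le dg (n :: iota 0 k) Kinj_nat; rewrite /= size_iota.
  apply: leq_trans; rewrite cnt_sum /cnt -cardsUI.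
  rewrite [X in (_ + X)%N](_ : _ = 0%N) ?addn0; last first.
    apply/eqP; rewrite cards_eq0; apply/eqP/setP => i; rewrite !inE nE.
    by case: eqP => [->|]; rewrite ?andbF // andbT ltnNge leqnSn.
  by apply/subset_leq_card/subsetP => i; rewrite !inE mem_iota add0n /= orbC.
- by move=> a _; rewrite /nu lez_nat (row_len_anti dg).
- by move=> a an; apply: ell_dom; rewrite /n in an; lia.
(* For odd [m] the index [n] is its own reverse, so dominance against [ell n = 0] shows that the
   last weight is nonnegative. *)
- move=> om; rewrite -/n; have <- : ell n = 0; last by apply: ell_dom; lia.
  by rewrite /ell (_ : (m - n.+1 = n)%N) ?subrr //; lia.
- move=> om n1; rewrite -/n in n1 *; have <- : ell n = - ell n.-1.
    by rewrite /ell opprB; congr ((cnt _)%:Z - (cnt _)%:Z); lia.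
  by apply: ell_dom; lia.
Qed.

(** As all partial sums agree, the dominance bound is an equality and [K0] is a column permutation
    of the filling by row indices; column alternation carries [g K0 != 0] over to [Krow]. *)
Lemma hw_superstandard (Krow : ix) : (forall i, Krow i = row i :> nat) -> g Krow != 0.
Proof.
move=> Kr.
have [|s sP] := @strict_card_eq _ _ _ dg l (fun i => K0 i) Kinj_nat rl.
  move=> j jl; have jn := leq_trans jl ln.
  rewrite -(sum_row_len (fun i => K0 i)) -sum_row_len; apply/eqP.
  rewrite eqn_leq cnt_le /=; have := partial_sums jn; rewrite sumrB nu_sum.
  have := ell_le j; rewrite -lez_nat.
  move: (\sum_(a < j) ell a) (\sum_(a < j) cnt a)%N (\sum_(a < j) row_len row a)%N; lia.
have -> : Krow = act_ix s K0.
  by apply/ffunP => i; rewrite ffunE; apply: val_inj; rewrite /= Kr (proj2 (sP i)).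
rewrite galt => [|i]; last exact: (proj1 (sP i)).
by rewrite mulf_neq0 // expf_neq0 // oppr_eq0 oner_eq0.
Qed.

End HighestVector.

(** A nonzero member would lead to a highest weight vector in [Y], which is nonzero at [Krow]. *)
Theorem hw_vanish (Y : tens -> Prop) (Krow : ix) :
  (forall i, Krow i = row i :> nat) ->
  (forall c f g, Y f -> Y g -> Y (fun K => c * f K + g K)) ->
  (forall a b f, a != b -> b != rev_ord a -> Y f -> Y (so_op a b f)) ->
  (forall f, Y f -> [/\ col_alternating col f, traceless f,
     young_eigen row col f & f Krow = 0]) ->
  forall f K, Y f -> f K = 0.
Proof.
move=> Kr Ylin Yso YP f K Yf; apply/eqP/negPn/negP => fK.
have [g [K0 [Yg gK0 gw ghw]]] := highest_weight m3 Ylin Yso Yf (ex_intro _ K fK).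
have [ga gt gy /eqP] := YP g Yg; apply/negP.
exact: (hw_superstandard gK0 gw ghw ga gt gy Kr).
Qed.

End HwVanish.

(** * Tensors vanishing at generic isotropic frames *)

Lemma deriv_prod (R : comNzRingType) (I : finType) (q : I -> {poly R}) :
  (\prod_i q i)^`() = \sum_i (q i)^`() * \prod_(j | j != i) q j.
Proof.
have := index_enum_uniq I.
elim: (index_enum I) => [|i r IHr] /=; first by rewrite !big_nil derivC.
case/andP => ir ur; rewrite !big_cons derivM IHr // eqxx /=; congr (_ * _ + _).
  rewrite big_seq [RHS]big_seq_cond; apply: eq_bigl => j.
  by case: (boolP (j \in r)) => //= jr; apply/esym; apply: contraNneq ir => <-.
rewrite mulr_sumr big_seq [RHS]big_seq; apply: eq_bigr => j jr.
rewrite big_cons (_ : i != j) 1?mulrCA //.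
by apply: contraNneq ir => ->.
Qed.

Lemma coef1_prod (R : comNzRingType) (I : finType) (q : I -> {poly R}) :
  (\prod_i q i)`_1 = \sum_i (q i)`_1 * \prod_(j | j != i) (q j)`_0.
Proof.
have E (p : {poly R}) : p`_1 = (p^`())`_0 by rewrite coef_deriv mulr1n.
rewrite E deriv_prod coef_sum; apply: eq_bigr => i _.
by rewrite coef0M -E coef0_prod.
Qed.

Lemma poly_zero_of_roots (F : numDomainType) (p : {poly F}) :
  (forall s, s != 0 -> p.[s] = 0) -> p = 0.
Proof.
move=> p0; apply/eqP/negPn/negP => pn0.
pose rs := [seq n.+1%:R : F | n <- iota 0 (size p)].
have := @max_poly_roots _ p rs pn0; rewrite size_map size_iota ltnn.
have -> : all (root p) rs.
  by apply/allP => _ /mapP[n _ ->]; apply/eqP/p0; rewrite pnatr_eq0.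
have -> // : uniq rs; last by move=> /(_ isT isT).
by rewrite map_inj_uniq ?iota_uniq // => i j /eqP; rewrite eqr_nat => /eqP[].
Qed.

Section TensorEvaluation.
Variables (F : numClosedFieldType) (m : nat) (I : finType).
Local Notation ix := {ffun I -> 'I_m}.

(** The ring [R] is arbitrary so that families of vectors with polynomial coordinates can be
    inserted. *)
Definition teval (R : comNzRingType) (f : ix -> R) (x : I -> 'I_m -> R) : R :=
  \sum_K f K * \prod_i x i (K i).

Lemma teval_lin (c : F) (f g : ix -> F) x :
  teval (fun K => c * f K + g K) x = c * teval f x + teval g x.
Proof.
by rewrite /teval mulr_sumr -big_split; apply: eq_bigr => K _; rewrite mulrDl mulrA.
Qed.

Lemma gl_op_teval a b (f : ix -> F) x :
  teval (gl_op a b f) x = \sum_i \sum_K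
    f K * ((K i == a)%:R * x i b * \prod_(j | j != i) x j (K j)).
Proof.
rewrite /teval /gl_op; under eq_bigr do rewrite mulr_suml.
rewrite exchange_big; apply: eq_bigr => i _ /=.
pose sw (K : ix) := upd_ix K i (tperm a b (K i)).
have swK : involutive sw.
  by move=> K; rewrite /sw upd_ix_id upd_ixE eqxx tpermK upd_ix_self.
rewrite (reindex_inj (inv_inj swK)); apply: eq_bigr => K _ /=.
rewrite {1}/sw upd_ixE eqxx {1}/sw upd_ix_id (can2_eq (tpermK a b) (tpermK a b)) tpermR.
case: eqP => [E|_]; last by rewrite !mul0r mulr0.
rewrite !mul1r -{1}E upd_ix_self (bigD1 i) //= /sw upd_ixE eqxx E tpermL.
congr (_ * (_ * _)); apply: eq_bigr => j /negPf ji.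
by rewrite upd_ixE ji.
Qed.

Definition antidiag : 'M[F]_m := \matrix_(i, j) (j == rev_ord i)%:R.

Definition so_mx (a b : 'I_m) : 'M[F]_m :=
  delta_mx b a - delta_mx (rev_ord a) (rev_ord b).

(** The right side is the derivative at [s = 0] of the value of [f] at the vectors
    [x i + s *: (x i *m so_mx a b)]. *)
Lemma so_op_teval a b (f : ix -> F) (x : I -> 'rV[F]_m) :
  teval (so_op a b f) (fun i => x i 0) = \sum_K f K *
    \sum_i (x i *m so_mx a b) 0 (K i) * \prod_(j | j != i) x j 0 (K j).
Proof.
transitivity (teval (gl_op a b f) (fun i => x i 0) -
    teval (gl_op (rev_ord b) (rev_ord a) f) (fun i => x i 0)).
  by rewrite -sumrB; apply: eq_bigr => K _; rewrite mulrBl.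
under [RHS]eq_bigr do rewrite mulr_sumr.
rewrite !gl_op_teval -sumrB [RHS]exchange_big /=; apply: eq_bigr => i _.
rewrite -sumrB; apply: eq_bigr => K _; rewrite -mulrBr -mulrBl.
congr (_ * (_ * _)).
have dE u v : (x i *m (delta_mx u v : 'M[F]_m)) 0 (K i) = (K i == v)%:R * x i 0 u.
  rewrite mxE (bigD1 u) //= big1 ?addr0 => [|w /negPf wu].
    by rewrite mxE eqxx mulrC.
  by rewrite mxE wu mulr0.
by rewrite -!dE /so_mx mulmxBr [RHS]mxE [X in _ = _ + X]mxE.
Qed.

Lemma antidiag_delta (u v : 'I_m) : delta_mx u v *m antidiag = delta_mx u (rev_ord v).
Proof.
apply/matrixP => i j; rewrite mxE (bigD1 v) //= big1 ?addr0 => [|w /negPf wv].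
  by rewrite !mxE eqxx andbT -natrM mulnb.
by rewrite !mxE wv andbF mul0r.
Qed.

Lemma antidiag_tr : antidiag^T = antidiag.
Proof.
apply/matrixP => i j; rewrite !mxE; congr (_%:R : F); congr nat_of_bool.
by apply/eqP/eqP => ->; rewrite rev_ordK.
Qed.

Lemma so_mx_skew a b : antidiag *m (so_mx a b)^T = - (so_mx a b *m antidiag).
Proof.
rewrite -{1}antidiag_tr -trmx_mul /so_mx mulmxBl !antidiag_delta rev_ordK.
by rewrite linearB /= !trmx_delta opprB.
Qed.

(** In the square only terms with [a] or [b] equal to its own reverse survive. Only one index can
    be, so at most one term is left, and a third factor kills it. *)
Lemma so_mx_cube a b : a != b -> so_mx a b *m so_mx a b *m so_mx a b = 0.
Proof.
move=> ab; have ba : b == a = false by rewrite eq_sym (negPf ab).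
have rab : rev_ord a == rev_ord b = false by rewrite (inj_eq rev_ord_inj) (negPf ab).
have rba : rev_ord b == rev_ord a = false by rewrite eq_sym.
have cl : (a == rev_ord a) && (b == rev_ord b) = false.
  apply/negbTE/negP => /andP[/eqP/(congr1 val)/= e1 /eqP/(congr1 val)/= e2].
  by move/eqP: ab; apply; apply/val_inj => /=; have := ltn_ord a; have := ltn_ord b; lia.
have {}ab := negPf ab.
have -> : so_mx a b *m so_mx a b = - (delta_mx b (rev_ord b) *+ (a == rev_ord a))
    - (delta_mx (rev_ord a) a *+ (rev_ord b == b)).
  rewrite {1}/so_mx mulmxBl /so_mx !mulmxBr !mul_delta_mx_cond ab rba.
  by rewrite !mulr0n sub0r subr0.
have [ara|] := boolP (a == rev_ord a).
  have brb : rev_ord b == b = false by move: cl; rewrite ara eq_sym.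
  rewrite brb mulr0n subr0 mulr1n mulNmx /so_mx mulmxBr !mul_delta_mx_cond brb rba.
  by rewrite !mulr0n subr0 oppr0.
move=> _; rewrite mulr0n oppr0 sub0r.
have [brb|] := boolP (rev_ord b == b); last by rewrite mulr0n oppr0 mul0mx.
have ara : a == rev_ord a = false by move: cl; rewrite [b == _]eq_sym brb andbT.
rewrite mulr1n mulNmx /so_mx mulmxBr !mul_delta_mx_cond ab ara.
by rewrite !mulr0n subr0 oppr0.
Qed.

End TensorEvaluation.

(** * Infinitesimal invariance of vanishing at generic frames *)

Section GenericFrames.
Variables (F : numClosedFieldType) (m l : nat) (I : finType).
Local Notation ix := {ffun I -> 'I_m}.
Variables (rho : I -> 'I_l.+1) (col : I -> nat) (V : 'M[F]_(m, l.+1)).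

Definition isotropic (b : 'M[F]_(l.+1, m)) : Prop := b *m antidiag F m *m b^T = 0.

(* [G] will be the Gram matrix of a frame [b] against fixed vectors, the first
   of which is [v]; the frame is generic when the value is nonzero. *)
Definition generic (R : comNzRingType) (G : 'M[R]_l.+1) : R := G 0 0 * \det G.

Definition generic_vanish (f : ix -> F) : Prop := forall b : 'M[F]_(l.+1, m),
  isotropic b -> generic (b *m V) != 0 -> teval f (fun i => b (rho i)) = 0.

(* The one-parameter subgroup [exp (s A)], as [A] will satisfy [A ^ 3 = 0]. *)
Definition eichler (A : 'M[F]_m) (s : F) (b : 'M[F]_(l.+1, m)) : 'M[F]_(l.+1, m) :=
  b + s *: (b *m A) + (2%:R^-1 * s ^+ 2) *: (b *m A *m A).

(** Skewness moves [A] across the form with a sign; the terms in [s] and [s ^+ 2] then cancel and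
    the higher ones contain [A ^ 3]. *)
Lemma eichler_isotropic (A : 'M[F]_m) s b :
  antidiag F m *m A^T = - (A *m antidiag F m) -> A *m A *m A = 0 ->
  isotropic b -> isotropic (eichler A s b).
Proof.
rewrite /isotropic; set J := antidiag F m => AJ A3 iso.
have T (X Y : 'M[F]_(l.+1, m)) : X *m J *m (Y *m A)^T = - (X *m A *m J *m Y^T).
  by rewrite trmx_mul mulmxA -(mulmxA X J) AJ mulmxN mulNmx !mulmxA.
have z : b *m A *m A *m A = 0 by rewrite -!mulmxA [A *m (A *m A)]mulmxA A3 mulmx0.
rewrite /eichler !linearD !linearZ /= !(mulmxDl, mulmxDr).
rewrite -?scalemxAl -?scalemxAr !T z iso ?mul0mx ?oppr0 ?scaler0 ?addr0 ?add0r.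
set P := b *m A *m J *m b^T; set Q := b *m A *m A *m J *m b^T.
rewrite !(scalerN, opprK, opprB, scaler0).
by move: P Q => P Q; apply/matrixP => i j; rewrite !mxE; field.
Qed.

(** Along the curve [eichler A s B] let [T] be the value of [f] and [Q] the genericity function,
    both polynomials in [s]. The product [T * Q] has all nonzero scalars as roots and [Q] is nonzero
    at 0, so [T = 0]; its coefficient of degree 1 is the value of [so_op a b f] at [B]. *)
Lemma generic_vanish_so a b f : a != b ->
  generic_vanish f -> generic_vanish (so_op a b f).
Proof.
move=> ab fv B isoB genB.
have sk := so_mx_skew F a b; have cube := so_mx_cube F ab.
set A := so_mx F a b in sk cube.
pose P : 'M[{poly F}]_(l.+1, m) := map_mx polyC B + 'X *: map_mx polyC (B *m A)
  + (2%:R^-1%:P * 'X^2) *: map_mx polyC (B *m A *m A).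
have PE s r c : (P r c).[s] = eichler A s B r c.
  by rewrite /P /eichler !mxE !hornerE.
pose Q : {poly F} := generic (P *m map_mx polyC V).
have QE s : Q.[s] = generic (eichler A s B *m V).
  have mE : map_mx (horner_eval s) (P *m map_mx polyC V) = eichler A s B *m V.
    rewrite map_mxM; congr (_ *m _); apply/matrixP => r c.
      by rewrite [LHS]mxE -PE.
    by rewrite !mxE; exact: hornerC.
  by rewrite /Q /generic hornerM -mE det_map_mx [X in _ = X * _]mxE.
pose T : {poly F} := teval (fun K => (f K)%:P) (fun i => P (rho i)).
have TE s : T.[s] = teval f (fun i => eichler A s B (rho i)).
  rewrite /T /teval horner_sum; apply: eq_bigr => K _.
  rewrite hornerM hornerC horner_prod; congr (_ * _).
  by apply: eq_bigr => i _; rewrite PE.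
have e0 : eichler A 0 B = B by rewrite /eichler !scale0r expr0n mulr0 scale0r !addr0.
have /eqP : T * Q = 0.
  apply: poly_zero_of_roots => s _; rewrite hornerM QE TE.
  have [->|gs] := eqVneq (generic (eichler A s B *m V)) 0; first by rewrite mulr0.
  by rewrite fv ?mul0r //; apply: eichler_isotropic.
rewrite mulf_eq0 orbC => /orP[/eqP Q0|/eqP T0].
  by move: genB; rewrite -[B]e0 -QE Q0 horner0 eqxx.
have T1 : T`_1 = 0 by rewrite T0 coef0.
rewrite -[RHS]T1 /T [in RHS]/teval coef_sum.
have c0 r c : (P r c)`_0 = B r c.
  by rewrite -horner_coef0 PE e0.
have c1 r c : (P r c)`_1 = (B *m A) r c.
  rewrite /P !mxE coefD coefD coefC add0r coefXM /= coefC /=.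
  by rewrite -mulrA coefCM [_ * _%:P]mulrC coefCM coefXn mulr0 mulr0 addr0.
have := so_op_teval a b f (fun i => row (rho i) B).
have -> : teval (so_op a b f) (fun i => row (rho i) B 0) =
    teval (so_op a b f) (fun i => B (rho i)).
  by apply: eq_bigr => K _; congr (_ * _); apply: eq_bigr => i _; rewrite mxE.
move=> ->; apply: eq_bigr => K _; rewrite coefCM coef1_prod; congr (_ * _).
apply: eq_bigr => i _; rewrite c1 -row_mul mxE; congr (_ * _).
by apply: eq_bigr => j _; rewrite c0 mxE.
Qed.

Let row i : nat := rho i.

(** The tensors with the four properties are stable under [so(W)]. The frame of the first [l.+1]
    basis vectors is isotropic and generic, and the value there is the coordinate at [Krow]. *)
Theorem frame_vanish (f : ix -> F) :
  is_diagram row col -> (2 < m)%N -> (l.+1 < uphalf m)%N ->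
  generic ((\matrix_(r < l.+1, c < m) (c == r :> nat)%:R) *m V) != 0 ->
  col_alternating col f -> traceless f -> young_eigen row col f ->
  generic_vanish f -> forall K, f K = 0.
Proof.
move=> dg m3 lm genV fa ft fy fv K.
have lm' (r : 'I_l.+1) : (r < m)%N.
  by apply: leq_trans (ltn_ord r) _; move: lm; rewrite uphalf_half; lia.
pose Krow : ix := [ffun i => Ordinal (lm' (rho i))].
pose Y (h : ix -> F) := [/\ col_alternating col h, traceless h,
  young_eigen row col h & generic_vanish h].
apply: (@hw_vanish F m I row col dg l.+1 _ lm m3 Y Krow) => //.
- by move=> i; exact: ltn_ord.
- by move=> i; rewrite ffunE.
- move=> c g h [ga gt gy gv] [ha ht hy hv]; split.
  + by move=> s sc L; rewrite ga // ha // mulrDr mulrCA.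
  + by move=> L i j ij; rewrite big_split /= -mulr_sumr gt // ht // mulr0 addr0.
  + move=> L; rewrite mulrDr mulrCA -gy -hy /swap_sum mulr_sumr -big_split.
    apply: eq_bigr => i _; by rewrite mulr_sumr -big_split.
  + by move=> b ib gb; rewrite teval_lin (gv b) // (hv b) // mulr0 addr0.
- move=> a b g ab _ [ga gt gy gv]; split.
  (* Linearity is available for [c * f + g], so the multiple of [g] by a scalar [d] is written as
     [(d - 1) * g + g]. *)
  + move=> s sc L; rewrite so_op_act (_ : (fun _ => _) = fun M => ((-1) ^+ s - 1) * g M + g M).
      by rewrite so_op_lin mulrBl mul1r subrK.
    by apply: funext => M; rewrite ga // mulrBl mul1r subrK.
  + exact: so_op_traceless.
  + move=> L; rewrite so_op_swap_sum (_ : swap_sum g = fun M =>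
      (pair_count F row - pair_count F col - 1) * g M + g M).
      by rewrite so_op_lin; ring.
    by apply: funext => M; rewrite gy; ring.
  + exact: generic_vanish_so.
- move=> g [ga gt gy gv]; split => //.
  have /(gv _) : isotropic (\matrix_(r < l.+1, c < m) (c == r :> nat)%:R).
    apply/matrixP => r s; rewrite !mxE big1 // => c _; rewrite !mxE mulr_suml big1 // => d _.
    rewrite !mxE; case: eqP => [dr|]; last by rewrite !mul0r.
    case: eqP => [cd|]; last by rewrite mulr0 mul0r.
    case: eqP => [cs|]; last by rewrite mulr0.
    have := congr1 val cd; rewrite /= cs dr; move: lm (ltn_ord r) (ltn_ord s).
    by rewrite uphalf_half; lia.
  move=> /(_ genV) <-; rewrite /teval (bigD1 Krow) //= big1 ?mulr1 => [|i _]; last first.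
    by rewrite mxE ffunE /= eqxx.
  rewrite big1 ?addr0 // => M MK.
  have [i iP] : exists i, M i != Krow i.
    apply/existsP; rewrite -negb_forall; apply: contra MK => /forallP h.
    by apply/eqP/ffunP => i; apply/eqP.
  rewrite (bigD1 i) //= mxE (_ : _ == _ = false) ?mul0r ?mulr0 //.
  by apply: contraNF iP => /eqP e; apply/eqP/val_inj; rewrite /= ffunE.
Qed.

End GenericFrames.

(** * Hyperbolic bases *)

Section SymmetricForms.
Variables (F : fieldType) (W : vectType F) (B : {symmetric W}).

Lemma symC x y : B x y = B y x.
Proof. by rewrite hermC expr0 mul1r. Qed.

Lemma symDr x y z : B x (y + z) = B x y + B x z.
Proof. exact: linearD. Qed.
Lemma symZr x c y : B x (c *: y) = c * B x y.
Proof. exact: linearZ. Qed.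
Lemma symDl x y z : B (x + y) z = B x z + B y z.
Proof. by rewrite ![B _ z]symC symDr. Qed.
Lemma symZl x c y : B (c *: x) y = c * B x y.
Proof. by rewrite ![B _ y]symC symZr. Qed.
Lemma symBr x y z : B x (y - z) = B x y - B x z.
Proof. exact: linearB. Qed.
Lemma symBl x y z : B (x - y) z = B x z - B y z.
Proof. by rewrite ![B _ z]symC symBr. Qed.
Lemma sym_sumr (J : Type) (r : seq J) (P : pred J) x (f : J -> W) :
  B x (\sum_(i <- r | P i) f i) = \sum_(i <- r | P i) B x (f i).
Proof. exact: linear_sum. Qed.
Lemma sym_suml (J : Type) (r : seq J) (P : pred J) x (f : J -> W) :
  B (\sum_(i <- r | P i) f i) x = \sum_(i <- r | P i) B (f i) x.
Proof. by rewrite symC sym_sumr; apply: eq_bigr => i _; rewrite symC. Qed.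

Lemma nondegenerate_eq0 x : nondegenerate B -> (forall y, B x y = 0) -> x = 0.
Proof.
move=> /eqP nd h; apply/eqP; rewrite -memv0 -nd.
by apply/mem_orthovP => y _; apply: h.
Qed.
End SymmetricForms.

Section OrthonormalBases.
Variables (F : numClosedFieldType) (W : vectType F) (B : {symmetric W}).
Hypothesis ndB : nondegenerate B.

Lemma sqrt_exists (c : F) : exists s, s ^+ 2 = c.
Proof. by exists (sqrtC c); rewrite sqrtCK. Qed.

(** Otherwise, by polarization, the form vanishes on the orthogonal complement of the [u i]. The
    component there of a vector outside their span is then orthogonal to everything, against
    nondegeneracy. *)
Lemma anisotropic_in_complement k (u : nat -> W) : (k < \dim {:W})%N ->
  (forall i j, (i < k)%N -> (j < k)%N -> B (u i) (u j) = (i == j)%:R) ->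
  exists z, (forall i, (i < k)%N -> B (u i) z = 0) /\ B z z != 0.
Proof.
move=> kd on.
pose proj x := \sum_(i < k) B (u i) x *: u i.
have perp x i : (i < k)%N -> B (u i) (x - proj x) = 0.
  move=> ik; rewrite symBr sym_sumr (bigD1 (Ordinal ik)) //= symZr on // eqxx.
  rewrite big1 ?addr0 ?mulr1 ?subrr // => j ji.
  by rewrite symZr on // eq_sym -[ i ]/(val (Ordinal ik)) val_eqE (negPf ji) mulr0.
have [x xn] : exists x, x != proj x.
  apply: contrapT => /forallNP no.
  suff : (fullv <= <<[seq u i | i <- iota 0 k]>>)%VS.
    move/dimvS => le; have := leq_trans le (dim_span _).
    by rewrite size_map size_iota leqNgt kd.
  apply/subvP => x _; have /negP := no x; rewrite negbK => /eqP ->.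
  apply: rpred_sum => i _; apply: rpredZ; apply: memv_span.
  by apply: map_f; rewrite mem_iota /=.
apply: contrapT => /forallNP iso.
have iso' z : (forall i, (i < k)%N -> B (u i) z = 0) -> B z z = 0.
  by move=> pz; apply/eqP/negPn/negP => nz; apply: (iso z).
have iso2 y z : (forall i, (i < k)%N -> B (u i) y = 0) ->
    (forall i, (i < k)%N -> B (u i) z = 0) -> B y z = 0.
  move=> py pz; have : B (y + z) (y + z) = 0.
    by apply: iso' => i ik; rewrite symDr py // pz // addr0.
  rewrite !symDr !symDl (iso' y) // (iso' z) // add0r addr0 (symC B z y).
  by rewrite -mulr2n => /eqP; rewrite mulrn_eq0 => /eqP.
move/eqP: xn; apply; apply/eqP; rewrite -subr_eq0; apply/eqP.
apply: (nondegenerate_eq0 ndB) => t.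
rewrite -[t](subrK (proj t)) symDr iso2 ?add0r; [|exact: perp|exact: perp].
by rewrite sym_sumr big1 // => i _; rewrite symZr symC perp ?mulr0.
Qed.

Lemma orthonormal_basis (v : W) : B v v != 0 ->
  exists2 u : nat -> W, (forall i j, (i < \dim {:W})%N -> (j < \dim {:W})%N ->
     B (u i) (u j) = (i == j)%:R) & exists2 c, c != 0 & v = c *: u 0%N.
Proof.
move=> vv; have [c c2] := sqrt_exists (B v v).
have c0 : c != 0 by apply: contraNneq vv => c0; rewrite -c2 c0 expr0n.
suff step k : (0 < k <= \dim {:W})%N -> exists2 u : nat -> W,
    (forall i j, (i < k)%N -> (j < k)%N -> B (u i) (u j) = (i == j)%:R) & v = c *: u 0%N.
  have [d0|d0] := posnP (\dim {:W}); last first.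
    have [|u on e] := step (\dim {:W}); first by rewrite d0 /=.
    by exists u => //; exists c.
  by exists (fun=> c^-1 *: v) => [i j|]; [rewrite d0|exists c; rewrite ?scalerA ?mulfV ?scale1r].
case: k => // k; elim: k => [|k IHk] kd.
  exists (fun=> c^-1 *: v); last by rewrite scalerA mulfV ?scale1r.
  by move=> [|//] [|//] _ _; rewrite symZl symZr -c2 expr2 mulKf // mulVf.
have [|u on e] := IHk; first by rewrite /= ltnW.
have [z [pz zz]] := anisotropic_in_complement kd on.
have [d d2] := sqrt_exists (B z z).
have d0 : d != 0 by apply: contraNneq zz => d0; rewrite -d2 d0 expr0n.
exists (fun i => if i == k.+1 then d^-1 *: z else u i) => // i j.
rewrite ltnS leq_eqVlt [(j < _)%N]ltnS [(j <= _)%N]leq_eqVlt.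
case: eqP => [->|_] /= ik; case: eqP => [->|_] /= jk.
- by rewrite eqxx symZl symZr -d2 expr2 mulKf // mulVf.
- by rewrite symZl symC pz // mulr0 gtn_eqF.
- by rewrite symZr pz // mulr0 ltn_eqF.
- exact: on.
Qed.

(** For each orthonormal pair [u a], [u (rev_ord a)] with [a < rev_ord a] take
    [r *: (u a + 'i *: u (rev_ord a))] and its conjugate, where [r ^+ 2 = 1 / 2]; a middle vector is
    kept. The first pair sums to [2 r] times [u 0], which is proportional to [v]. *)
Lemma hyperbolic_basis m (v : W) : \dim {:W} = m -> B v v != 0 ->
  exists2 w : 'I_m -> W, (forall a b, B (w a) (w b) = (b == rev_ord a)%:R) &
  exists2 c, c != 0 & forall a : 'I_m, (a < rev_ord a)%N -> a = 0%N :> nat ->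
    v = c *: (w a + w (rev_ord a)).
Proof.
move=> dm vv; have [u on [c c0 vE]] := orthonormal_basis vv.
rewrite {}dm in on.
have [r r2] := sqrt_exists (2%:R^-1 : F).
have r0 : r != 0.
  by apply/eqP => e; move/eqP: r2; rewrite e expr0n eq_sym invr_eq0 pnatr_eq0.
have rr : r * r + r * r = 1 by rewrite -expr2 r2; field.
have ii : 'i * 'i = -1 :> F by rewrite -expr2 sqrCi.
pose al (a : 'I_m) : F :=
  if (a < rev_ord a)%N then r else if a == rev_ord a then 1 else - 'i * r.
pose be (a : 'I_m) : F :=
  if (a < rev_ord a)%N then 'i * r else if a == rev_ord a then 0 else r.
pose w a := al a *: u a + be a *: u (rev_ord a).
exists w => [a b|].
  have onE (x y : 'I_m) : B (u x) (u y) = (x == y)%:R by rewrite on.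
  rewrite /w symDl !symDr !symZl !symZr !onE [rev_ord a == rev_ord b](inj_eq rev_ord_inj).
  have -> : (a == rev_ord b) = (b == rev_ord a).
    by apply/eqP/eqP => ->; rewrite rev_ordK.
  rewrite [rev_ord a == b]eq_sym.
  have [ba|ba] := eqVneq b (rev_ord a).
    rewrite ba; have [ara|ara] := eqVneq a (rev_ord a).
      by rewrite /al /be -!ara ltnn eqxx !(mulr0, mulr1, mul0r, addr0).
    rewrite /al /be rev_ordK (negPf ara) [rev_ord a == a]eq_sym (negPf ara).
    rewrite !mulr0 !mulr1 add0r addr0.
    case: (ltngtP a (rev_ord a)) => [_|_|/val_inj e].
    - by rewrite [X in _ + X]mulrACA mulrN ii opprK mul1r rr.
    - by rewrite [X in X + _]mulrACA mulNr ii opprK mul1r rr.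
    - by move: ara; rewrite -e eqxx.
  rewrite !mulr0 !addr0 add0r; have [ab|] := eqVneq a b; last by rewrite !mulr0 addr0.
  have ara : a == rev_ord a = false by rewrite {1}ab (negPf ba).
  rewrite -ab /al /be ara !mulr1; case: ifP => _.
    by rewrite mulrACA ii mulN1r subrr.
  by rewrite mulrACA mulrNN ii mulN1r addNr.
exists (c * r); first exact: mulf_neq0.
move=> a lt a0; rewrite /w /al /be rev_ordK lt ltnNge (ltnW lt) /=.
rewrite -val_eqE /= gtn_eqF // vE.
rewrite a0; set x := u 0%N; set y := u (m - 1)%N.
rewrite [X in _ + X]addrC addrACA -!scalerDl mulNr subrr scale0r addr0.
by rewrite scalerA -mulrA mulrDr rr mulr1.
Qed.
End OrthonormalBases.

(** * Young symmetrizers *)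

Section PartitionDiagrams.
Variable la : seq nat.
Hypothesis la_part : is_partition la.

Definition brow (k : 'I_(sumn la)) : nat := reshape_index la k.
Definition bcol (k : 'I_(sumn la)) : nat := reshape_offset la k.

Lemma box_at r c : (c < nth 0%N la r)%N -> exists k, brow k = r /\ bcol k = c.
Proof.
move=> cr; exists (Ordinal (flatten_indexP cr)).
by rewrite /brow /bcol /= (flatten_indexKl cr) (flatten_indexKr cr).
Qed.

Lemma bcol_lt k : (bcol k < nth 0%N la (brow k))%N.
Proof. exact: reshape_offsetP. Qed.

Lemma brow_lt k : (brow k < size la)%N.
Proof. exact: reshape_indexP. Qed.

Lemma part_anti r s : (r <= s)%N -> (nth 0%N la s <= nth 0%N la r)%N.
Proof.
move=> rs; have [sl|sl] := ltnP s (size la); last by rewrite nth_default.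
have /andP[so _] := la_part.
have geT : transitive geq by move=> x y z /= h1 h2; apply: leq_trans h2 h1.
apply: (sorted_leq_nth geT _ 0%N so) => //=; first by move=> x; exact: leqnn.
by rewrite inE (leq_ltn_trans rs).
Qed.

Lemma partition_diagram : is_diagram brow bcol.
Proof.
split.
- move=> i j rij cij; apply: val_inj.
  rewrite /= -(reshape_indexK la i) -(reshape_indexK la j).
  by rewrite -/(brow i) -/(brow j) -/(bcol i) -/(bcol j) rij cij.
- move=> i r ri; have [|j [rj cj]] := @box_at r (bcol i); last by exists j.
  exact: leq_trans (bcol_lt i) (part_anti (ltnW ri)).
Qed.

End PartitionDiagrams.

Section YoungSymmetrizers.
Variables (F : numClosedFieldType) (W : vectType F).
Local Notation ix := 'I_(\dim {:W}).
Local Notation tpow I := {ffun {ffun I -> ix} -> F^o}.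

Lemma tactM (I : finType) (s u : {perm I}) (y : tpow I) :
  tact s (tact u y) = tact (s * u)%g y.
Proof.
apply: (@pure_eq _ _ I _ (tact s \o tact u) (tact (s * u)%g)) => w /=.
by rewrite !tact_pure; congr pure; apply: funext => i; rewrite permM.
Qed.

Definition tswap (I : finType) (y : tpow I) : tpow I :=
  \sum_i \sum_(j | j != i) tact (tperm i j) y.

Lemma tact_tswap (I : finType) s (y : tpow I) : tact s (tswap y) = tswap (tact s y).
Proof.
rewrite /tswap linear_sum (reindex_inj (@perm_inj _ s)) /=; apply: eq_bigr => i _.
rewrite linear_sum (reindex_inj (@perm_inj _ s)) /=.
apply: eq_big => [j|j _]; first by rewrite (inj_eq perm_inj).
rewrite !tactM -tpermJ conjgE.
by rewrite mulgA mulgA mulgV mul1g.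
Qed.

Variable la : seq nat.
Hypothesis la_part : is_partition la.
Local Notation n := (sumn la).
Implicit Types y z : tpow 'I_n.

Lemma col_groupP (s : {perm 'I_n}) :
  reflect (forall k, bcol (s k) = bcol k) (s \in col_group la).
Proof.
rewrite inE; apply: (iffP forallP) => h k; first exact/eqP/h.
by apply/eqP/(h k).
Qed.

Lemma row_groupP (s : {perm 'I_n}) :
  reflect (forall k, brow (s k) = brow k) (s \in row_group la).
Proof.
rewrite inE; apply: (iffP forallP) => h k; first exact/eqP/h.
by apply/eqP/(h k).
Qed.

Lemma col_groupM s u : u \in col_group la ->
  ((u * s)%g \in col_group la) = (s \in col_group la).
Proof.
move=> /col_groupP cu; apply/col_groupP/col_groupP => h k.
  by have := h (u^-1 k)%g; rewrite permM permKV -(cu (u^-1 k)%g) permKV.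
by rewrite permM h cu.
Qed.

Lemma col_groupMr s u : u \in col_group la ->
  ((s * u)%g \in col_group la) = (s \in col_group la).
Proof.
move=> /col_groupP cu; apply/col_groupP/col_groupP => h k.
  by rewrite -(h k) permM cu.
by rewrite permM cu h.
Qed.

Lemma row_groupM s u : u \in row_group la ->
  ((u * s)%g \in row_group la) = (s \in row_group la).
Proof.
move=> /row_groupP cu; apply/row_groupP/row_groupP => h k.
  by have := h (u^-1 k)%g; rewrite permM permKV -(cu (u^-1 k)%g) permKV.
by rewrite permM h cu.
Qed.

Lemma tact_row_sym u y : u \in row_group la -> tact u (row_sym y) = row_sym y.
Proof.
move=> ru; rewrite /row_sym linear_sum [RHS](reindex_inj (mulgI u)) /=.
apply: eq_big => [s|s _]; first by rewrite row_groupM.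
exact: tactM.
Qed.

Lemma tact_col_alt u y : u \in col_group la ->
  tact u (col_alt y) = (-1) ^+ u *: col_alt y.
Proof.
move=> cu; rewrite /col_alt linear_sum [in RHS](reindex_inj (mulgI u)) /= scaler_sumr.
apply: eq_big => [s|s _]; first by rewrite col_groupM.
rewrite linearZ /= tactM scalerA odd_permM signr_addb mulrA.
by rewrite -signr_addb addbb expr0 mul1r.
Qed.

Lemma col_alt_tact u y : u \in col_group la ->
  col_alt (tact u y) = (-1) ^+ u *: col_alt y.
Proof.
move=> cu; rewrite /col_alt [in RHS](reindex_inj (mulIg u)) /= scaler_sumr.
apply: eq_big => [s|s _]; first by rewrite col_groupMr.
rewrite tactM scalerA odd_permM signr_addb mulrCA mulrA.
by rewrite -mulrA -signr_addb addbb expr0 mulr1.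
Qed.

Lemma col_alt_sum (J : finType) (P : pred J) (f : J -> tpow 'I_n) :
  col_alt (\sum_(j | P j) f j) = \sum_(j | P j) col_alt (f j).
Proof.
rewrite /col_alt exchange_big /=; apply: eq_bigr => s _.
by rewrite (linear_sum (tact s)) scaler_sumr.
Qed.

Lemma col_alt_tswap y : col_alt (tswap y) = tswap (col_alt y).
Proof.
rewrite {1}/col_alt; under eq_bigr do rewrite tact_tswap /tswap scaler_sumr.
rewrite exchange_big /= /tswap; apply: eq_bigr => i _.
under eq_bigr do rewrite scaler_sumr.
rewrite exchange_big /=; apply: eq_bigr => j _.
by rewrite /col_alt linear_sum; apply: eq_bigr => s _; rewrite linearZ.
Qed.

Lemma self_opp_eq0 y : y = - y -> y = 0.
Proof.
move/eqP; rewrite -subr_eq0 opprK -mulr2n -scaler_nat scaler_eq0 pnatr_eq0.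
by move/eqP.
Qed.

(* The two boxes span a rectangle one of whose other corners [k] lies in the
   diagram; [tperm j k] and [tperm i k] are then column and row permutations. *)
Lemma col_alt_tperm_row_sym i j y : brow i <> brow j -> bcol i <> bcol j ->
  col_alt (tact (tperm i j) (row_sym y)) = 0.
Proof.
wlog rij : i j / (brow i < brow j)%N => [th|_ cij].
  move=> rij cij; case: (ltngtP (brow i) (brow j)) => [lt|lt|//]; first exact: th.
  by rewrite tpermC; apply: th => //; exact: nesym.
have [_ up] := partition_diagram la_part.
have [k [rk ck]] := up j _ rij.
have cs : tperm j k \in col_group la.
  by apply/col_groupP => x; case: tpermP => // ->.
have rs : tperm i k \in row_group la.
  by apply/row_groupP => x; case: tpermP => // ->.
have jk : j != k by apply: contraTneq rij => ->; rewrite rk ltnn.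
have ik : i != k by apply/eqP => e; apply: cij; rewrite e.
have ij : i != j by apply/eqP => e; apply: cij; rewrite e.
apply: self_opp_eq0.
have := col_alt_tact (tact (tperm i j) (row_sym y)) cs.
rewrite odd_tperm jk expr1 scaleN1r => <-.
rewrite -[in LHS](tact_row_sym y rs) !tactM; congr (col_alt (tact _ _)).
have e : (tperm j k ^ tperm i j)%g = tperm i k.
  by rewrite tpermJ tpermR tpermD.
by rewrite -e conjgE tpermV !mulgA tperm2 mul1g.
Qed.

(** The sum of all transpositions commutes with [col_alt]. Applied between the two symmetrizers, a
    transposition gives [1] for boxes in a common row, [- 1] in a common column, and 0 otherwise. *)
Lemma young_sym_tswap y :
  tswap (young_sym y) =
  (pair_count F (@brow la) - pair_count F (@bcol la)) *: young_sym y.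
Proof.
rewrite /young_sym -col_alt_tswap /tswap col_alt_sum /pair_count -sumrB scaler_suml.
apply: eq_bigr => i _; rewrite col_alt_sum -sumrB scaler_suml; apply: eq_bigr => j ji.
have [rij|/eqP rij] := eqVneq (brow i) (brow j); have [cij|/eqP cij] := eqVneq (bcol i) (bcol j).
- have [inj _] := partition_diagram la_part.
  by rewrite (inj _ _ rij cij) eqxx in ji.
- rewrite subr0 scale1r tact_row_sym //.
  by apply/row_groupP => x; case: tpermP => [->|->|].
- rewrite sub0r scaleN1r col_alt_tact.
    by rewrite odd_tperm eq_sym ji expr1 scaleN1r.
  by apply/col_groupP => x; case: tpermP => [->|->|].
- by rewrite subrr scale0r col_alt_tperm_row_sym.
Qed.

End YoungSymmetrizers.

(** * Tensors as multilinear forms *)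

Section Evaluation.
Variables (F : numClosedFieldType) (W : vectType F) (B : {symmetric W}).
Local Notation bx := 'I_(\dim {:W}).
Local Notation e := (fun a : bx => (vbasis {:W})`_a).
Local Notation tpow I := {ffun {ffun I -> bx} -> F^o}.

(** The multilinear form which corresponds to [y] under the identification of [W] with its dual by
    [B]. *)
Definition ev (I : finType) (y : tpow I) (x : I -> W) : F :=
  textend (V := F^o) (fun w => \prod_i B (w i) (x i)) y.

Lemma evE (I : finType) (y : tpow I) x :
  ev y x = \sum_K (y K : F) * \prod_i B (e (K i)) (x i).
Proof. by []. Qed.

Lemma prod_upd (I : finType) (w x : I -> W) i z :
  \prod_k B (upd w i z k) (x k) =
  B z (x i) * \prod_(k | k != i) B (w k) (x k).
Proof.
rewrite (bigD1 i) //= /upd eqxx; congr (_ * _).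
by apply: eq_bigr => k /negPf ->.
Qed.

Lemma ev_pure (I : finType) (w x : I -> W) : ev (pure w) x = \prod_i B (w i) (x i).
Proof.
rewrite /ev (textend_pure (V := F^o)) // => {}w i a u v.
by rewrite !prod_upd symDl symZl mulrDl -mulrA.
Qed.

Lemma ev_lin (I : finType) a (y z : tpow I) x : ev (a *: y + z) x = a * ev y x + ev z x.
Proof. by rewrite /ev linearP. Qed.
Lemma evZ (I : finType) a (y : tpow I) x : ev (a *: y) x = a * ev y x.
Proof. by rewrite /ev linearZ. Qed.
Lemma ev_sum (I J : finType) (P : pred J) (f : J -> tpow I) x :
  ev (\sum_(j | P j) f j) x = \sum_(j | P j) ev (f j) x.
Proof. by rewrite /ev linear_sum. Qed.
Lemma ev0 (I : finType) x : ev (0 : tpow I) x = 0.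
Proof. by rewrite /ev linear0. Qed.

Lemma ev_eq (I J : finType) (L : {linear tpow I -> tpow J}) x x' :
  (forall w, ev (L (pure w)) x = ev (pure w) x') ->
  forall y, ev (L y) x = ev y x'.
Proof.
move=> h y.
apply: (@pure_eq _ _ I _ (textend (V := F^o) (fun w => \prod_i B (w i) (x i)) \o L)
  (textend (V := F^o) (fun w => \prod_i B (w i) (x' i)))) => w; exact: h.
Qed.

Lemma ev_tact (I : finType) (s : {perm I}) (y : tpow I) x :
  ev (tact s y) x = ev y (fun i => x (s^-1 i)%g).
Proof.
apply: (ev_eq (L := tact s)) => w /=; rewrite tact_pure !ev_pure.
rewrite [RHS](reindex_inj (@perm_inj _ s)) /=; apply: eq_bigr => i _.
by rewrite permK.
Qed.

Lemma ev_tmap (I : finType) (g : 'End(W)) (y : tpow I) x :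
  (forall u v, B (g u) (g v) = B u v) -> ev (tmap g y) (fun i => g (x i)) = ev y x.
Proof.
move=> gB; apply: (ev_eq (L := tmap g)) => w /=; rewrite tmap_pure !ev_pure.
by apply: eq_bigr => i _; rewrite gB.
Qed.

Lemma ev_updr (I : finType) (y : tpow I) x i a u v :
  ev y (upd x i (a *: u + v)) = a * ev y (upd x i u) + ev y (upd x i v).
Proof.
rewrite !evE mulr_sumr -big_split; apply: eq_bigr => K _ /=.
have E z : \prod_k B (e (K k)) (upd x i z k) =
    B (e (K i)) z * \prod_(k | k != i) B (e (K k)) (x k).
  rewrite (bigD1 i) //= {1}/upd eqxx; congr (_ * _).
  by apply: eq_bigr => k /negPf ki; rewrite /upd ki.
rewrite !E symDr symZr; ring.
Qed.

Lemma ev_scale (I : finType) (y : tpow I) (c : I -> F) x :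
  ev y (fun i => c i *: x i) = (\prod_i c i) * ev y x.
Proof.
rewrite !evE mulr_sumr; apply: eq_bigr => K _.
rewrite mulrCA; congr (_ * _); rewrite -big_split; apply: eq_bigr => i _ /=.
by rewrite symZr.
Qed.

Lemma ev_expand (I : finType) (y : tpow I) n (w : 'I_n -> W) (c : I -> 'I_n -> F) :
  ev y (fun i => \sum_a c i a *: w a) =
  teval (fun K : {ffun I -> 'I_n} => ev y (fun i => w (K i))) c.
Proof.
rewrite /teval evE.
under [RHS]eq_bigr do rewrite evE mulr_suml.
rewrite exchange_big /=; apply: eq_bigr => K _.
under eq_bigr do rewrite sym_sumr.
rewrite bigA_distr_bigA mulr_sumr; apply: eq_bigr => J _.
rewrite -mulrA -big_split; congr (_ * _); apply: eq_bigr => i _ /=.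
by rewrite symZr mulrC.
Qed.

Section HyperbolicBasis.
Variables (m : nat) (w : 'I_m -> W).
Hypothesis dimW : \dim {:W} = m.
Hypothesis ndB : nondegenerate B.
Hypothesis wE : forall a b, B (w a) (w b) = (b == rev_ord a)%:R.

Let nth_w (a : 'I_m) : [tuple w i | i < m]`_a = w a.
Proof. by rewrite -tnth_nth tnth_mktuple. Qed.

Lemma hyp_span : (fullv <= <<[tuple w i | i < m]>>)%VS.
Proof.
have fr : free [tuple w i | i < m].
  apply/freeP => k k0 a.
  have := congr1 (fun z => B z (w (rev_ord a))) k0.
  rewrite sym_suml (bigD1 a) // symZl nth_w wE eqxx mulr1.
  rewrite big1 /= ?addr0 => [->|b ba]; first by rewrite symC linear0.
  by rewrite symZl nth_w wE (inj_eq rev_ord_inj) eq_sym (negPf ba) mulr0.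
move: fr; rewrite /free size_tuple => /eqP dm.
by rewrite -(dimv_leqif_sup (subvf _)).2 dm dimW.
Qed.

Lemma hyp_expand x : x = \sum_a B x (w (rev_ord a)) *: w a.
Proof.
apply/eqP; rewrite -subr_eq0; apply/eqP; apply: (nondegenerate_eq0 ndB) => y.
have yS : y \in <<[tuple w i | i < m]>>%VS by apply: (subvP hyp_span); exact: memvf.
rewrite (coord_span yS) sym_sumr big1 // => b _.
rewrite symZr nth_w symBl sym_suml (bigD1 (rev_ord b)) //=.
rewrite symZl wE rev_ordK eqxx mulr1 big1 ?addr0 ?subrr ?mulr0 // => a ab.
rewrite symZl wE; case: eqP => [e0|_]; last by rewrite mulr0.
by rewrite e0 rev_ordK eqxx in ab.
Qed.

Lemma hyp_pair x y : \sum_a B x (w a) * B y (w (rev_ord a)) = B x y.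
Proof.
rewrite [in RHS](hyp_expand y) sym_sumr; apply: eq_bigr => a _.
by rewrite symZr mulrC.
Qed.

Lemma hyp_dual a : exists x, forall y, coord (vbasis {:W}) a y = B y x.
Proof.
exists (\sum_b coord (vbasis {:W}) a (w b) *: w (rev_ord b)) => y.
rewrite {1}(hyp_expand y) linear_sum sym_sumr; apply: eq_bigr => b _.
by rewrite linearZ symZr mulrC.
Qed.

(** Values at basis vectors, that is, the covariant coordinates on which [gl_op] acts. *)
Definition coords (I : finType) (y : tpow I) (K : {ffun I -> 'I_m}) : F :=
  ev y (fun i => w (K i)).

Lemma ev_coords (I : finType) (y : tpow I) (x : I -> W) :
  ev y x = teval (coords y) (fun i a => B (x i) (w (rev_ord a))).
Proof.
rewrite -ev_expand; congr ev; apply: funext => i; exact: hyp_expand.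
Qed.

Lemma coords_eq0 (I : finType) (y : tpow I) : (forall K, coords y K = 0) -> y = 0.
Proof.
move=> y0; apply/ffunP => J; rewrite [RHS]ffunE.
have [d dE] := choice hyp_dual.
transitivity (ev y (fun i => d (J i))); last first.
  by rewrite ev_coords /teval big1 // => K _; rewrite y0 mul0r.
rewrite evE (bigD1 J) //= big1 ?mulr1 => [|i _]; last first.
  by rewrite -dE coord_free ?eqxx // (basis_free (vbasisP _)).
rewrite big1 ?addr0 // => K KJ.
have [i iK] : exists i, K i != J i.
  apply/existsP; rewrite -negb_forall; apply: contra KJ => /forallP h.
  by apply/eqP/ffunP => i; apply/eqP.
rewrite (bigD1 i) //= -dE coord_free ?(basis_free (vbasisP _)) //.
by rewrite (negPf iK) mul0r mulr0.
Qed.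

Lemma coords_contract (I : finType) (y : tpow I) i j K : i != j ->
  \sum_c coords y (upd_ix (upd_ix K i c) j (rev_ord c)) =
  ev (contract B i j y) (fun k => w (K (val k))).
Proof.
move=> ij.
have [c yE] : exists c : {ffun I -> bx} -> F,
    y = \sum_J c J *: pure (fun k => e (J k)) by exists y; exact: pure_span.
rewrite {}yE linear_sum ev_sum.
transitivity (\sum_a \sum_J c J * ev (pure (fun k => e (J k)))
    (fun k => w (upd_ix (upd_ix K i a) j (rev_ord a) k))).
  apply: eq_bigr => a _; rewrite /coords ev_sum.
  by apply: eq_bigr => J _; rewrite evZ.
rewrite exchange_big; apply: eq_bigr => J _ /=.
rewrite linearZ evZ /= contract_pure // evZ ev_pure -mulr_sumr; congr (_ * _).
rewrite -(big_sub (fun k => (k != i) && (k != j)) (fun k => B (e (J k)) (w (K k)))).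
rewrite -(hyp_pair (e (J i))) mulr_suml; apply: eq_bigr => a _.
rewrite ev_pure (bigD1 i) //= (bigD1 j) 1?eq_sym //= !upd_ixE eqxx (negPf ij) eqxx mulrA.
congr (_ * _); apply: eq_bigr => k /andP[ki kj].
by rewrite !upd_ixE (negPf ki) (negPf kj).
Qed.

End HyperbolicBasis.
End Evaluation.

(** * Traceless tensors of a given shape *)

Section SoModules.
Variables (F : numClosedFieldType) (W : vectType F) (B : {symmetric W}).
Variable la : seq nat.
Hypothesis la_part : is_partition la.
Local Notation n := (sumn la).
Local Notation bx := 'I_(\dim {:W}).
Local Notation tpow I := {ffun {ffun I -> bx} -> F^o}.
Implicit Type y : tpow 'I_n.

Lemma so_moduleP y :
  reflect ((exists z, y = young_sym z) /\
     forall i j, i != j -> contract B i j y = 0) (y \in so_module B la).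
Proof.
apply: (iffP memv_capP) => [[/memv_imgP[z _ yE] yc]|[[z yE] yc]]; split.
- by exists z; rewrite yE lfunE.
- move=> i j ij; move: yc; rewrite memvE => /subv_bigcapP/(_ (i, j) ij).
  by rewrite -memvE memv_ker lfunE /= => /eqP.
- by rewrite yE -lfunE; apply: memv_img; exact: memvf.
- rewrite memvE; apply/subv_bigcapP => -[i j] ij; rewrite -memvE memv_ker lfunE /=.
  by rewrite yc.
Qed.

Lemma ev_swap_col y x (s : {perm 'I_n}) : y \in so_module B la -> (forall k, bcol (s k) = bcol k) ->
  ev B y (fun k => x (s k)) = (-1) ^+ s * ev B y x.
Proof.
move=> /so_moduleP[[z ->] _] cs.
have cs' : (s^-1)%g \in col_group la.
  by apply/col_groupP => k; rewrite -(cs (s^-1 k)%g) permKV.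
rewrite -[X in ev _ _ X](_ : (fun i => x (s^-1^-1 i)%g) = _); last first.
  by apply: funext => k; rewrite invgK.
by rewrite -ev_tact tact_col_alt // evZ odd_permV.
Qed.

Section Omega.
Variable b : nat -> W.

(** For a basis [b] of an isotropic subspace this is the classical highest weight vector, up to a
    scalar. *)
Definition omega : tpow 'I_n := young_sym (pure (fun k => b (brow k))).

Lemma row_sym_rows : row_sym (pure (fun k : 'I_n => b (brow k))) =
  #|row_group la|%:R *: pure (fun k => b (brow k)).
Proof.
rewrite /row_sym (eq_bigr (fun=> pure (fun k => b (brow k)))) => [|s].
  by rewrite sumr_const scaler_nat.
move=> /row_groupP rs; rewrite tact_pure; congr pure.
by apply: funext => k; rewrite rs.
Qed.

Lemma omegaE : omega = #|row_group la|%:R *: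
  \sum_(s in col_group la) (-1) ^+ s *: pure (fun k => b (brow (s k))).
Proof.
rewrite /omega /young_sym row_sym_rows /col_alt scaler_sumr; apply: eq_bigr => s _.
by rewrite linearZ /= tact_pure !scalerA mulrC.
Qed.

Lemma omega_in : (forall r s, (r < size la)%N -> (s < size la)%N -> B (b r) (b s) = 0) ->
  omega \in so_module B la.
Proof.
move=> iso; apply/so_moduleP; split; first by eexists.
move=> i j ij; rewrite omegaE linearZ linear_sum /= big1 ?scaler0 // => s _.
by rewrite linearZ /= contract_pure // iso ?brow_lt // scale0r scaler0.
Qed.

(** A column permutation other than the identity moves some box to another row, where the pairing is
    0. *)
Lemma ev_omega (a : nat -> W) (c : nat -> F) :
  (forall r s, (r < size la)%N -> (s < size la)%N -> B (b r) (a s) = c r *+ (r == s)) ->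
  ev B omega (fun k => a (brow k)) =
  #|row_group la|%:R * \prod_(k < n) c (brow k).
Proof.
move=> ba; rewrite omegaE evZ ev_sum; congr (_ * _).
have c1 : (1%g : {perm 'I_n}) \in col_group la by apply/col_groupP => k; rewrite perm1.
rewrite (bigD1 1%g) //= [X in _ + X]big1 ?addr0 => [|s /andP[/col_groupP cs s1]].
  rewrite evZ odd_perm1 expr0 mul1r ev_pure; apply: eq_bigr => k _.
  by rewrite perm1 ba ?brow_lt // eqxx mulr1n.
rewrite evZ ev_pure.
have [k sk] : exists k, brow (s k) != brow k.
  apply/existsP; rewrite -negb_forall; apply: contra s1 => /forallP rs.
  apply/eqP/permP => k; rewrite perm1; have [inj _] := partition_diagram la_part.
  by apply: inj; [exact/eqP/rs|exact: cs].
by rewrite (bigD1 k) //= ba ?brow_lt // (negPf sk) mulr0n mul0r mulr0.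
Qed.

Lemma omega_neq0 (a : nat -> W) (c : nat -> F) :
  (forall r s, (r < size la)%N -> (s < size la)%N -> B (b r) (a s) = c r *+ (r == s)) ->
  (forall r, c r != 0) -> ev B omega (fun k => a (brow k)) != 0.
Proof.
move=> ba c0; rewrite (ev_omega ba) mulf_neq0 //.
  rewrite pnatr_eq0 -lt0n; apply/card_gt0P; exists 1%g.
  by apply/row_groupP => k; rewrite perm1.
by rewrite prodf_seq_neq0; apply/allP => k _; rewrite c0.
Qed.

End Omega.

Section Irreducibility.
Variables (m : nat) (w : 'I_m -> W).
Hypothesis dimW : \dim {:W} = m.
Hypothesis ndB : nondegenerate B.
Hypothesis wE : forall a b, B (w a) (w b) = (b == rev_ord a)%:R.

Lemma so_coords_alt y : y \in so_module B la -> col_alternating (@bcol la) (coords B w y).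
Proof.
move=> yS s cs K; rewrite -(ev_swap_col _ yS cs) /coords; congr ev.
by apply: funext => i; rewrite ffunE.
Qed.

Lemma so_coords_traceless y : y \in so_module B la -> traceless (coords B w y).
Proof.
move=> /so_moduleP[_ yc] K i j ij.
by rewrite (coords_contract dimW ndB wE _ _ ij) yc // ev0.
Qed.

Lemma so_coords_eigen y : y \in so_module B la ->
  young_eigen (@brow la) (@bcol la) (coords B w y).
Proof.
move=> /so_moduleP[[z ->] _] K.
rewrite -[RHS]evZ -young_sym_tswap // /swap_sum /tswap /coords ev_sum.
apply: eq_bigr => i _; rewrite ev_sum; apply: eq_bigr => j _.
rewrite ev_tact; congr ev; apply: funext => k.
by rewrite ffunE tpermV.
Qed.

Variables (l : nat) (rho : 'I_n -> 'I_l.+1) (vec : 'I_l.+1 -> W).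
Hypothesis rhoE : forall k, rho k = brow k :> nat.
Hypothesis m3 : (2 < m)%N.
Hypothesis lm : (l.+1 < uphalf m)%N.
Variable std : 'I_l.+1 -> 'I_m.
Hypothesis stdE : forall r, std r = r :> nat.
Hypothesis vec_gen : generic (\matrix_(r, s) B (w (std r)) (vec s)) != 0.

Theorem so_module_vanish y : y \in so_module B la ->
  (forall b : 'I_l.+1 -> W, (forall r s, B (b r) (b s) = 0) ->
    generic (\matrix_(r, s) B (b r) (vec s)) != 0 ->
    ev B y (fun k => b (rho k)) = 0) -> y = 0.
Proof.
move=> yS yv; apply: (coords_eq0 dimW ndB wE) => K.
pose V : 'M[F]_(m, l.+1) := \matrix_(c, s) B (w c) (vec s).
have brho : (fun k => rho k : nat) = @brow la by apply: funext.
apply: (@frame_vanish F m l 'I_n rho (@bcol la) V (coords B w y)) => //.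
- by rewrite brho; exact: partition_diagram.
- congr (generic _ != 0): vec_gen; apply/matrixP => r s; rewrite !mxE (bigD1 (std r)) //=.
  rewrite !mxE stdE eqxx mul1r big1 ?addr0 // => c cr; rewrite !mxE -stdE.
  by rewrite val_eqE (negPf cr) mul0r.
- exact: so_coords_alt.
- exact: so_coords_traceless.
- by rewrite brho; exact: so_coords_eigen.
move=> b isob genb.
pose bb r : W := \sum_c b r c *: w c.
have := yv bb; rewrite (ev_expand B y w (fun k => b (rho k))); apply.
- move=> r s; transitivity ((b *m antidiag F m *m b^T) r s); last by rewrite isob mxE.
  rewrite /bb sym_suml mxE; under [RHS]eq_bigr do rewrite mxE mulr_suml.
  rewrite [RHS]exchange_big; apply: eq_bigr => c _ /=.
  rewrite symZl sym_sumr mulr_sumr; apply: eq_bigr => d _.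
  by rewrite symZr wE !mxE; ring.
congr (generic _ != 0): genb; apply/matrixP => r s; rewrite !mxE sym_suml.
by apply: eq_bigr => c _; rewrite symZl mxE.
Qed.

End Irreducibility.
End SoModules.

(** * Scalings of hyperbolic subspaces *)

Section SquaresOfIsometries.
Variables (F : fieldType) (W : vectType F) (B : {symmetric W}).
Hypothesis ndB : nondegenerate B.
Local Notation e := (vbasis {:W}).
Import passmx.

Lemma isometry_det (g : 'End(W)) : (forall x y, B (g x) (g y) = B x y) ->
  \det (mxof e e g) ^+ 2 = 1.
Proof.
move=> gB; have eb : basis_of fullv e := vbasisP fullv.
pose G : 'M[F]_(\dim {:W}) := \matrix_(i, j) B e`_i e`_j.
have GE (u v : 'rV_(\dim {:W})) : B (vecof e u) (vecof e v) = (u *m G *m v^T) 0 0.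
  rewrite /vecof sym_suml mxE; under [RHS]eq_bigr do rewrite mxE mulr_suml.
  rewrite [RHS]exchange_big; apply: eq_bigr => i _ /=.
  rewrite symZl sym_sumr mulr_sumr; apply: eq_bigr => j _.
  by rewrite symZr !mxE mulrA mulrAC.
have inv : mxof e e g *m G *m (mxof e e g)^T = G.
  apply/matrixP => i j.
  have entry A : (('e_i : 'rV[F]_(\dim {:W})) *m A *m ('e_j : 'rV[F]_(\dim {:W}))^T) 0 0 = A i j.
    by rewrite -rowE trmx_delta -colE !mxE.
  rewrite -[LHS]entry -[RHS]entry -GE -gB !(hom_vecof e eb) GE trmx_mul.
  by rewrite !mulmxA.
have G0 : \det G != 0.
  apply/det0P => -[u u0 uG].
  have : vecof e u = 0.
    apply: (nondegenerate_eq0 ndB) => y.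
    by rewrite -[y](rVofK eb) GE uG mul0mx mxE.
  move=> /(congr1 (rVof e)); rewrite vecofK // linear0 => z.
  by rewrite z eqxx in u0.
have := congr1 determinant inv; rewrite !det_mulmx det_tr mulrAC -expr2.
by move/(canRL (mulfK G0)) ->; rewrite mulfV.
Qed.

Lemma isometry_sq_SO (g : 'End(W)) : (forall x y, B (g x) (g y) = B x y) ->
  in_SO B (g \o g)%VF.
Proof.
move=> gB; split=> [x y|]; first by rewrite !comp_lfunE !gB.
by rewrite (mxof_comp e e (vbasisP _)) det_mulmx -expr2 isometry_det.
Qed.
End SquaresOfIsometries.

Section HyperbolicScaling.
Variables (F : fieldType) (W : vectType F) (B : {symmetric W}).
Variables (J : finType) (p q : J -> W).
Hypothesis pp : forall i j, B (p i) (p j) = 0.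
Hypothesis qq : forall i j, B (q i) (q j) = 0.
Hypothesis pq : forall i j, B (p i) (q j) = (i == j)%:R.

(** The map multiplying each [p j] by [s] and each [q j] by [s^-1], and fixing the vectors
    orthogonal to all of them. *)
Definition scale_fun (s : F) (x : W) : W := x +
  \sum_j (((s - 1) * B (q j) x) *: p j + ((s^-1 - 1) * B (p j) x) *: q j).

Fact scale_fun_linear s : linear (scale_fun s).
Proof.
move=> a x y; rewrite /scale_fun scalerDr scaler_sumr addrACA -big_split /=.
congr (_ + _); apply: eq_bigr => j _.
rewrite !symDr !symZr scalerDr !scalerA addrACA -!scalerDl.
by congr (_ *: _ + _ *: _); ring.
Qed.
HB.instance Definition _ s := GRing.isSemilinear.Build F W W _ (scale_fun s)
  (GRing.semilinear_linear (scale_fun_linear s)).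

Definition hscale (s : F) : 'End(W) := linfun (scale_fun s).

Lemma hscaleE s x : hscale s x = scale_fun s x.
Proof. by rewrite lfunE. Qed.

Lemma scale_p s j x : s != 0 -> B (p j) (scale_fun s x) = s^-1 * B (p j) x.
Proof.
move=> s0; rewrite /scale_fun symDr sym_sumr (bigD1 j) //= symDr !symZr pp pq eqxx mulr1.
rewrite big1 ?addr0 => [|i ij]; first by ring.
by rewrite symDr !symZr pp pq eq_sym (negPf ij) !mulr0 addr0.
Qed.

Lemma scale_q s j x : s != 0 -> B (q j) (scale_fun s x) = s * B (q j) x.
Proof.
move=> s0; rewrite /scale_fun symDr sym_sumr (bigD1 j) //= symDr !symZr qq.
rewrite [B (q j) (p j)]symC pq eqxx mulr1 big1 ?addr0 => [|i ij]; first by ring.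
by rewrite symDr !symZr qq [B (q j) _]symC pq (negPf ij) !mulr0 addr0.
Qed.

Lemma hscale_isometry s x y : s != 0 -> B (hscale s x) (hscale s y) = B x y.
Proof.
move=> s0; rewrite !hscaleE {1}/scale_fun symDl sym_suml.
rewrite {1}/scale_fun symDr sym_sumr -addrA -big_split /= big1 ?addr0 // => j _.
rewrite symDl symDr !symZl !symZr scale_p // scale_q // !(symC B x); field.
exact: s0.
Qed.

Lemma hscale_p s j : hscale s (p j) = s *: p j.
Proof.
rewrite hscaleE /scale_fun (bigD1 j) //= symC pq eqxx pp mulr0 scale0r addr0 mulr1.
rewrite big1 ?addr0 => [|i ij]; first by rewrite scalerBl scale1r addrC subrK.
by rewrite symC pq eq_sym (negPf ij) pp !mulr0 !scale0r addr0.
Qed.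

Lemma hscale_q s j : hscale s (q j) = s^-1 *: q j.
Proof.
rewrite hscaleE /scale_fun (bigD1 j) //= pq eqxx qq mulr0 scale0r add0r mulr1.
rewrite big1 ?addr0 => [|i ij]; first by rewrite scalerBl scale1r addrC subrK.
by rewrite pq (negPf ij) qq !mulr0 !scale0r addr0.
Qed.

Lemma hscale_fix s x : (forall j, B (p j) x = 0) -> (forall j, B (q j) x = 0) ->
  hscale s x = x.
Proof.
move=> px qx; rewrite hscaleE /scale_fun big1 ?addr0 // => j _.
by rewrite px qx !mulr0 !scale0r addr0.
Qed.

Lemma hscaleK s x : s != 0 -> hscale s (hscale s^-1 x) = x.
Proof.
move=> s0; rewrite [hscale s^-1 x]hscaleE {1}/scale_fun linearD linear_sum /=.
rewrite [hscale s x]hscaleE {1}/scale_fun -addrA -big_split /= big1 ?addr0 // => j _.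
rewrite linearD !linearZ /= hscale_p hscale_q !scalerA addrACA -!scalerDl invrK.
rewrite [X in X *: p j](_ : _ = 0); last by field.
by rewrite [X in X *: q j](_ : _ = 0) ?scale0r ?addr0 //; field.
Qed.

(* Squared, so that the determinant is [1] without computing it. *)
Definition hscale2 (s : F) : 'End(W) := (hscale s \o hscale s)%VF.

Lemma hscale2_SO s : nondegenerate B -> s != 0 -> in_SO B (hscale2 s).
Proof. by move=> nd s0; apply: isometry_sq_SO => // x y; apply: hscale_isometry. Qed.

Lemma hscale2_p s j : hscale2 s (p j) = s ^+ 2 *: p j.
Proof. by rewrite comp_lfunE hscale_p linearZ /= hscale_p scalerA. Qed.

Lemma hscale2_q s j : hscale2 s (q j) = s ^- 2 *: q j.
Proof. by rewrite comp_lfunE hscale_q linearZ /= hscale_q scalerA -exprVn. Qed.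

Lemma hscale2_fix s x : (forall j, B (p j) x = 0) -> (forall j, B (q j) x = 0) ->
  hscale2 s x = x.
Proof. by move=> px qx; rewrite comp_lfunE !hscale_fix. Qed.

Lemma hscale2K s x : s != 0 -> hscale2 s (hscale2 s^-1 x) = x.
Proof. by move=> s0; rewrite !comp_lfunE !hscaleK. Qed.

Lemma hscale2E s x : s != 0 -> hscale2 s x = x +
  \sum_j (((s ^+ 2 - 1) * B (q j) x) *: p j + ((s ^- 2 - 1) * B (p j) x) *: q j).
Proof.
move=> s0; rewrite comp_lfunE [hscale s x]hscaleE {1}/scale_fun linearD linear_sum /=.
rewrite [hscale s x]hscaleE {1}/scale_fun -addrA -big_split; congr (_ + _).
apply: eq_bigr => j _ /=.
rewrite linearD !linearZ /= hscale_p hscale_q !scalerA addrACA -!scalerDl.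
by congr (_ *: _ + _ *: _); field.
Qed.
End HyperbolicScaling.

Section ScalingDegree.
Variables (F : numClosedFieldType) (W : vectType F) (B : {symmetric W}).
Variables (J : finType) (p q : J -> W).
Hypothesis pp : forall i j, B (p i) (p j) = 0.
Hypothesis qq : forall i j, B (q i) (q j) = 0.
Hypothesis pq : forall i j, B (p i) (q j) = (i == j)%:R.
Local Notation bx := 'I_(\dim {:W}).
Local Notation e := (fun a : bx => (vbasis {:W})`_a).
Local Notation tpow I := {ffun {ffun I -> bx} -> F^o}.

(** Multiplied by [s ^+ 2], each coordinate of [hscale2 s x] becomes a polynomial of degree at most
    2 in [s ^+ 2]. For tensors this bounds the weights of the scaling by the number of factors. *)
Lemma tmap_scale_degree (I : finType) (L : {linear tpow I -> F^o}) (y : tpow I) :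
  exists2 P : {poly F}, (size P <= (#|I|.*2).+1)%N &
    forall s, s != 0 -> P.[s ^+ 2] = (s ^+ 2) ^+ #|I| * L (tmap (hscale2 B p q s) y).
Proof.
pose E (a : bx) (x : W) : {poly F} :=
  (coord (vbasis {:W}) a x)%:P * 'X +
  (\sum_j B (q j) x * coord (vbasis {:W}) a (p j))%:P * ('X^2 - 'X) +
  (\sum_j B (p j) x * coord (vbasis {:W}) a (q j))%:P * (1 - 'X).
have szE a x : (size (E a x) <= 3)%N.
  have szM (c : F) (r : {poly F}) : (size r <= 3)%N -> (size (c%:P * r)%R <= 3)%N.
    by rewrite mul_polyC => h; apply: leq_trans (size_scale_leq _ _) h.
  have szD (r r' : {poly F}) : (size r <= 3)%N -> (size r' <= 3)%N -> (size (r + r')%R <= 3)%N.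
    by move=> h h'; rewrite (leq_trans (size_polyD _ _)) // geq_max h.
  by rewrite !(szD, szM) ?size_polyN ?size_polyX ?size_polyXn ?size_poly1.
have EE s a x : s != 0 ->
    (E a x).[s ^+ 2] = s ^+ 2 * coord (vbasis {:W}) a (hscale2 B p q s x).
  move=> s0; have -> : coord (vbasis {:W}) a (hscale2 B p q s x) =
      coord (vbasis {:W}) a x +
      (\sum_j (s ^+ 2 - 1) * B (q j) x * coord (vbasis {:W}) a (p j) +
       \sum_j (s ^- 2 - 1) * B (p j) x * coord (vbasis {:W}) a (q j)).
    rewrite hscale2E // linearD linear_sum -big_split; congr (_ + _).
    by apply: eq_bigr => j _; rewrite linearD !linearZ.
  rewrite /E !(hornerD, hornerM, hornerC, hornerX, hornerXn, hornerN) !(mulrDr (s ^+ 2)) -!addrA.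
  congr (_ + (_ + _)); first by rewrite mulrC.
    by rewrite mulr_suml mulr_sumr; apply: eq_bigr => j _; ring.
  by rewrite mulr_suml mulr_sumr; apply: eq_bigr => j _; field.
exists (\sum_(K : {ffun I -> bx}) \sum_(M : {ffun I -> bx})
  ((y K : F) * L (pure (fun i => e (M i))))%:P * \prod_i E (M i) (e (K i))).
  rewrite (leq_trans (size_sum _ _ _)) //; apply/bigmax_leqP => K _.
  rewrite (leq_trans (size_sum _ _ _)) //; apply/bigmax_leqP => M _.
  rewrite mul_polyC (leq_trans (size_scale_leq _ _)) //.
  have le3 : (\sum_(i : I) size (E (M i) (e (K i))) <= #|I| * 3)%N.
    by rewrite -sum_nat_const; apply: leq_sum.
  rewrite (leq_trans (size_prod_leq _ _)) // leq_subLR.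
  apply: (@leq_trans (#|I| * 3).+1); first by rewrite ltnS.
  rewrite [X in (_ <= X + _)%N](_ : _ = #|I|) //; lia.
move=> s s0; rewrite horner_sum {1}/tmap /textend linear_sum mulr_sumr.
apply: eq_bigr => K _; rewrite horner_sum linearZ /=.
rewrite {1}[pure _]pure_span /textend linear_sum scaler_sumr mulr_sumr.
apply: eq_bigr => M _; rewrite linearZ /= hornerM hornerC horner_prod.
rewrite (eq_bigr (fun i => s ^+ 2 * coord (vbasis {:W}) (M i) (hscale2 B p q s (e (K i))))).
  rewrite big_split /= prodr_const pureE.
  rewrite -[_ *: (_ *: _)]/(y K * (\prod_i coord (vbasis fullv) (M i) (hscale2 B p q s (e (K i)))
    * L (pure (fun i => e (M i))))).
  by rewrite cardT -cardE; ring.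
by move=> i _; rewrite EE.
Qed.
End ScalingDegree.

(** * Failure of surjectivity *)

Section Standard.
Variables (F : numClosedFieldType) (W : vectType F) (B : {symmetric W}).
Variables (m : nat) (w : 'I_m -> W).
Hypothesis wE : forall a b, B (w a) (w b) = (b == rev_ord a)%:R.

(** The basis with natural indices, extended by 0, which avoids ordinals in index arithmetic. *)
Definition wn (k : nat) : W := oapp w 0 (insub k).

Lemma wn_val (a : 'I_m) : wn a = w a.
Proof. by rewrite /wn valK. Qed.

Lemma wnE i j : (i < m)%N -> (j < m)%N -> B (wn i) (wn j) = (i + j.+1 == m)%:R.
Proof.
move=> im jm; rewrite (wn_val (Ordinal im)) (wn_val (Ordinal jm)) wE -val_eqE /=.
by congr (nat_of_bool _)%:R; lia.
Qed.

Hypothesis ndB : nondegenerate B.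
Variables (mu nu : seq nat).
Hypothesis nu_part : is_partition nu.
Hypothesis size_nu : ((size nu).+1.*2 <= m)%N.
Hypothesis sumn_nu : sumn nu = (sumn mu).+1.
Variable phi : 'Hom(W, 'Hom(subvs_of (so_module B mu), subvs_of (so_module B nu))).
Hypothesis phi_eq : SO_equivariant phi.
Variable v : W.
(** This holds for [v] in the span of the first and last basis vectors; the scaled subspaces are
    spanned by basis vectors in between. *)
Hypothesis wv : forall k, (0 < k < m.-1)%N -> B (wn k) v = 0.

Theorem not_surjective : ~ (forall y, exists x, phi v x = y).
Proof.
move=> sur.
pose l := size nu.
pose p (j : 'I_l) := wn j.+1; pose q (j : 'I_l) := wn (m - j.+2).
have pp i j : B (p i) (p j) = 0.
  rewrite wnE; [|have := ltn_ord i; rewrite /l; lia|have := ltn_ord j; rewrite /l; lia].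
  by rewrite (_ : _ == _ = false) //; have := ltn_ord i; have := ltn_ord j; rewrite /l; lia.
have qq i j : B (q i) (q j) = 0.
  rewrite wnE; [|lia|lia].
  by rewrite (_ : _ == _ = false) //; have := ltn_ord i; have := ltn_ord j; rewrite /l; lia.
have pq i j : B (p i) (q j) = (i == j)%:R.
  rewrite wnE; [|have := ltn_ord i; rewrite /l; lia|lia].
  congr (nat_of_bool _)%:R; rewrite -val_eqE /=.
  by have := ltn_ord i; have := ltn_ord j; rewrite /l; lia.
have pv i : B (p i) v = 0 by apply: wv; have := ltn_ord i; rewrite /l; lia.
have qv i : B (q i) v = 0 by apply: wv; have := ltn_ord i; rewrite /l; lia.
pose b r := wn r.+1; pose a r := wn (m - r.+2).
have om_in : omega nu b \in so_module B nu.
  by apply: omega_in => // r s rl sl; apply: (pp (Ordinal rl) (Ordinal sl)).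
have om0 : ev B (omega nu b) (fun k => a (brow k)) != 0.
  apply: (@omega_neq0 _ _ _ _ nu_part b a (fun=> 1)) => [r s rl sl|_]; last exact: oner_neq0.
  by rewrite (pq (Ordinal rl) (Ordinal sl)) -val_eqE.
set c := ev B _ _ in om0.
have [x phix] := sur (vsproj _ (omega nu b)).
(* The value of [phi v] at the frame [a]; the projection [vsproj] only makes it defined on all
   tensors. *)
pose L : {linear _ -> F^o} :=
  textend (V := F^o) (fun z => \prod_k B (z k) (a (brow k))) \o
  (vsval \o (phi v \o vsproj (so_module B mu))).
have [P szP PE] := tmap_scale_degree pp qq pq L (vsval x).
(* As [h] fixes [v], it commutes with [phi v], so the value is that of [omega nu b], of weight
   [|nu|]; the further power [|mu|] clears denominators. *)
have key s : s != 0 -> P.[s ^+ 2] = c * (s ^+ 2) ^+ (sumn mu + sumn nu).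
  move=> s0; rewrite PE // card_ord exprD mulrCA; congr (_ * _).
  set h := hscale2 B p q s.
  have hSO : in_SO B h by exact: hscale2_SO.
  have := phi_eq hSO v x; rewrite hscale2_fix // phix => act.
  have -> : L (tmap h (vsval x)) = ev B (tmap h (omega nu b)) (fun k => a (brow k)).
    rewrite /L /= -/(so_act h x) act /so_act vsprojK ?vsprojK //.
    exact: tmap_so_module.
  have := ev_tmap (omega nu b) (fun k : 'I_(sumn nu) => a (brow k)) (proj1 hSO).
  have -> : (fun k : 'I_(sumn nu) => h (a (brow k))) = (fun k => s ^- 2 *: a (brow k)).
    by apply: funext => k; exact: (hscale2_q qq pq s (Ordinal (brow_lt k))).
  rewrite (ev_scale _ _ (fun=> s ^- 2)) prodr_const card_ord -/c => <-.
  by rewrite mulrAC -exprMn mulVf ?expf_neq0 // expr1n mul1r.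
have e : P - c *: 'X^(sumn mu + sumn nu) = 0.
  apply: poly_zero_of_roots => t t0.
  have [s st] := sqrt_exists t.
  have s0 : s != 0 by apply: contraNneq t0 => s0; rewrite -st s0 expr0n.
  by rewrite !hornerE -st key // subrr.
(* The degree of [P] is at most [2 |mu|], below the exponent [|mu| + |nu| = 2 |mu| + 1], at which
   the coefficient would be [c]. *)
have := congr1 (fun r : {poly F} => r`_(sumn mu + sumn nu)) e.
rewrite coefB coefZ coefXn eqxx mulr1 coef0 nth_default ?sub0r.
  by move=> /eqP; rewrite oppr_eq0 (negPf om0).
by rewrite (leq_trans szP) // card_ord sumn_nu; lia.
Qed.

End Standard.

(** * The bilinear form on tensors *)

Section TensorForm.
Variables (F : numClosedFieldType) (W : vectType F) (B : {symmetric W}).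
Local Notation bx := 'I_(\dim {:W}).
Local Notation e := (fun a : bx => (vbasis {:W})`_a).
Local Notation tpow I := {ffun {ffun I -> bx} -> F^o}.

Definition tform (I : finType) (y z : tpow I) : F :=
  textend (V := F^o) (ev B z) y.

Lemma tform_pure (I : finType) x (z : tpow I) : tform (pure x) z = ev B z x.
Proof.
rewrite /tform (textend_pure (V := F^o)) // => {}x i a u v.
by rewrite ev_updr.
Qed.

Lemma tformZl (I : finType) a (y z : tpow I) : tform (a *: y) z = a * tform y z.
Proof. by rewrite /tform linearZ. Qed.

Lemma tform_suml (I J : finType) (P : pred J) (f : J -> tpow I) z :
  tform (\sum_(j | P j) f j) z = \sum_(j | P j) tform (f j) z.
Proof. by rewrite /tform linear_sum. Qed.

Lemma tform_linr (I : finType) (y : tpow I) a z z' :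
  tform y (a *: z + z') = a * tform y z + tform y z'.
Proof.
rewrite /tform /textend; under eq_bigr do rewrite ev_lin.
rewrite mulr_sumr -big_split; apply: eq_bigr => K _ /=.
by rewrite -[_ *: _]/(y K * _) mulrDr mulrCA.
Qed.

Lemma tform0r (I : finType) (y : tpow I) : tform y 0 = 0.
Proof.
by have := tform_linr y (-1) 0 0; rewrite scaler0 addr0 mulN1r addNr.
Qed.

Lemma tformZr (I : finType) (y : tpow I) a z : tform y (a *: z) = a * tform y z.
Proof. by rewrite -[a *: z]addr0 tform_linr tform0r addr0. Qed.

Lemma tform_sumr (I J : finType) (f : J -> tpow I) y :
  tform y (\sum_j f j) = \sum_j tform y (f j).
Proof.
apply: (big_morph (tform y)) => [z z'|]; last exact: tform0r.
by rewrite -[z]scale1r tform_linr scale1r mul1r.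
Qed.

Lemma tform_tmap (I : finType) (g : 'End(W)) (y z : tpow I) :
  (forall u v, B (g u) (g v) = B u v) -> tform (tmap g y) (tmap g z) = tform y z.
Proof.
move=> gB; rewrite {1}[y]pure_span /textend linear_sum tform_suml.
rewrite [in RHS]/tform /textend; apply: eq_bigr => K _.
by rewrite linearZ tformZl /= tmap_pure tform_pure ev_tmap.
Qed.

Lemma tmapK (I : finType) (g g' : 'End(W)) (y : tpow I) :
  (forall x, g (g' x) = x) -> tmap g (tmap g' y) = y.
Proof.
move=> gK; apply: (@pure_eq _ _ I _ (tmap g \o tmap g') idfun) => x /=.
by rewrite !tmap_pure; congr pure; apply: funext => i; rewrite gK.
Qed.

(** Nondegeneracy makes the Gram matrix of a basis of [S] invertible, and the coordinates of [x] are
    obtained with its inverse. *)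
Lemma tform_represents (I : finType) (S : {vspace tpow I}) (L : {linear tpow I -> F^o}) :
  (forall z, z \in S -> (forall y, y \in S -> tform y z = 0) -> z = 0) ->
  exists2 x, x \in S & forall y, y \in S -> tform y x = L y.
Proof.
move=> nd; pose X := vbasis S.
pose M : 'M[F]_(\dim S) := \matrix_(i, j) tform X`_j X`_i.
have Xin (i : 'I_(\dim S)) : X`_i \in S by rewrite vbasis_mem // memt_nth.
have comb (u : 'rV[F]_(\dim S)) : \sum_i u 0 i *: X`_i \in S.
  by apply: rpred_sum => i _; apply: rpredZ.
have onbasis (l1 l2 : tpow I -> F) :
  (forall c (f : 'I_(\dim S) -> tpow I), l1 (\sum_i c i *: f i) = \sum_i c i * l1 (f i)) ->
  (forall c (f : 'I_(\dim S) -> tpow I), l2 (\sum_i c i *: f i) = \sum_i c i * l2 (f i)) ->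
  (forall i : 'I_(\dim S), l1 X`_i = l2 X`_i) -> forall y, y \in S -> l1 y = l2 y.
  move=> h1 h2 h12 y /coord_vbasis ->; rewrite h1 h2.
  by apply: eq_bigr => i _; rewrite h12.
have linl z c (f : 'I_(\dim S) -> tpow I) :
    tform (\sum_i c i *: f i) z = \sum_i c i * tform (f i) z.
  by rewrite tform_suml; apply: eq_bigr => i _; rewrite tformZl.
have MU : M \in unitmx.
  rewrite unitmxE unitfE; apply/det0P => -[u u0 uM].
  have z0 : \sum_i u 0 i *: X`_i = 0.
    apply: nd => // y yS.
    apply: (onbasis (fun y0 => tform y0 _) (fun=> 0) (linl _) _ _ y yS).
      by move=> c f; rewrite big1 // => i _; rewrite mulr0.
    move=> j; have := congr1 (fun N : 'rV_(\dim S) => N 0 j) uM.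
    rewrite mxE [RHS]mxE => <-; rewrite tform_sumr; apply: eq_bigr => i _.
    by rewrite tformZr mxE.
  have := basis_free (vbasisP S) => /freeP/(_ _ z0) u00.
  by move/eqP: u0; apply; apply/rowP => i; rewrite mxE u00.
pose Lr : 'rV[F]_(\dim S) := \row_j L X`_j.
pose u := Lr *m invmx M.
exists (\sum_i u 0 i *: X`_i) => // y yS; apply: (onbasis (fun y0 => tform y0 _) L (linl _) _ _ y yS).
  by move=> c f; rewrite linear_sum; apply: eq_bigr => i _; rewrite linearZ.
move=> j; have := congr1 (fun N : 'rV_(\dim S) => N 0 j) (mulmxKV MU Lr).
rewrite mxE [RHS]mxE => <-; rewrite tform_sumr; apply: eq_bigr => i _.
by rewrite tformZr [X in _ = _ * X]mxE.
Qed.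

Section ColumnRelations.
Variable la : seq nat.
Hypothesis la_part : is_partition la.
Implicit Type y : tpow 'I_(sumn la).

Lemma ev_col_repeat y x i j : y \in so_module B la ->
  i != j -> bcol i = bcol j -> x i = x j -> ev B y x = 0.
Proof.
move=> yS ij cij xij.
have := @ev_swap_col F W B la y x (tperm i j) yS.
have -> : (fun k => x (tperm i j k)) = x.
  by apply: funext => k; case: tpermP => [->|->|].
rewrite odd_tperm ij expr1 mulN1r => h.
have /eqP : ev B y x = - ev B y x.
  by apply: h => k; case: tpermP => [->|->|].
by rewrite -addr_eq0 -mulr2n mulrn_eq0 => /eqP.
Qed.

(* A box outside the first row has the first vector [b 0] above it, so adding
   multiples of [b 0] to the other vectors changes nothing. *)
Lemma ev_shear y (b : nat -> W) (c : nat -> F) : y \in so_module B la -> c 0%N = 0 ->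
  ev B y (fun k => b (brow k) + c (brow k) *: b 0%N) = ev B y (fun k => b (brow k)).
Proof.
move=> yS c0.
pose x (T : seq 'I_(sumn la)) (k : 'I_(sumn la)) :=
  b (brow k) + (if k \in T then c (brow k) else 0) *: b 0%N.
have step T : ev B y (x T) = ev B y (fun k => b (brow k)).
  elim: T => [|k T IHT].
    by congr ev; apply: funext => k; rewrite /x in_nil scale0r addr0.
  have [kT|kT] := boolP (k \in T).
    rewrite -IHT; congr ev; apply: funext => i; rewrite /x inE.
    by case: eqP => // ->; rewrite kT.
  have -> : x (k :: T) = upd (x T) k (c (brow k) *: b 0%N + x T k).
    apply: funext => i; rewrite /x /upd inE; case: eqP => [->|//] /=.
    by rewrite (negPf kT) scale0r addr0 addrC.
  rewrite ev_updr updE IHT.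
  have [bk|bk] := posnP (brow k); first by rewrite bk c0 mul0r add0r.
  have [_ up] := partition_diagram la_part.
  have [k0 [rk0 ck0]] := up k 0%N bk.
  have k0k : k0 != k by apply: contraTneq bk => <-; rewrite rk0.
  rewrite (ev_col_repeat (i := k0) (j := k) yS) ?mulr0 ?add0r // /upd eqxx (negPf k0k).
  by rewrite /x rk0 c0; case: ifP; rewrite scale0r addr0.
rewrite -(step (enum 'I_(sumn la))); congr ev; apply: funext => k.
by rewrite /x mem_enum.
Qed.

(** Column alternation of [y] absorbs the signs in [omega], so pairing with [omega] amounts to
    evaluation at the frame. *)
Lemma tform_omega y (b : nat -> W) : y \in so_module B la ->
  tform (omega la b) y =
  (#|row_group la| * #|col_group la|)%:R * ev B y (fun k => b (brow k)).
Proof.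
move=> yS; rewrite omegaE tformZl tform_suml natrM -mulrA; congr (_ * _).
rewrite (eq_bigr (fun=> ev B y (fun k => b (brow k)))) => [|s /col_groupP cs].
  by rewrite sumr_const mulr_natl.
rewrite tformZl tform_pure (@ev_swap_col F W B la y (fun k => b (brow k)) s yS cs).
by rewrite mulrA -signr_addb addbb expr0 mul1r.
Qed.

End ColumnRelations.
End TensorForm.

(** * Failure of injectivity *)

Section NotInjective.
Variables (F : numClosedFieldType) (W : vectType F) (B : {symmetric W}).
Variables (m : nat) (w : 'I_m -> W).
Hypothesis dimW : \dim {:W} = m.
Hypothesis ndB : nondegenerate B.
Hypothesis wE : forall a b, B (w a) (w b) = (b == rev_ord a)%:R.
Local Notation wn := (wn w).
Variables (mu nu : seq nat) (l : nat).
Hypothesis mu_part : is_partition mu.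
Hypothesis nu_part : is_partition nu.
Hypothesis mu_size : (size mu <= l.+1)%N.
Hypothesis nu_size : (size nu <= l.+1)%N.
Hypothesis lm : (l.+2.*2 <= m)%N.

Definition lower (la : seq nat) : nat := #|[set k : 'I_(sumn la) | brow k != 0%N]|.
Hypothesis lower_nu : lower nu = (lower mu).+1.
Variable phi : 'Hom(W, 'Hom(subvs_of (so_module B mu), subvs_of (so_module B nu))).
Hypothesis phi_eq : SO_equivariant phi.
Variable v : W.
Hypothesis wv : forall k, (0 < k < m.-1)%N -> B (wn k) v = 0.
Hypothesis w0v : B (wn 0) v != 0.

(** The vectors defining the linear form represented by [x]: [v] for the first row, then isotropic
    vectors orthogonal to [v]. By [wn_vec] they are dual to the [wn r] up to scalars. *)
Definition vec (r : nat) : W := if r == 0%N then v else wn (m - r.+1).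

Let m3 : (2 < m)%N. Proof. lia. Qed.
Let lum : (l.+1 < uphalf m)%N. Proof. by rewrite uphalf_half; lia. Qed.

Lemma wn_vec r s : (r <= l)%N -> (s <= l)%N ->
  B (wn r) (vec s) = (if r == 0%N then B (wn 0) v else 1) *+ (r == s).
Proof.
move=> rl sl; rewrite /vec; have [->|s0] := eqVneq s 0%N.
  have [->//|r0] := eqVneq r 0%N; rewrite mulr0n wv //; lia.
rewrite (wnE wE); [|lia|lia].
have [->|r0] := eqVneq r 0%N.
  by rewrite [0%N == s]eq_sym (negPf s0) mulr0n (_ : _ == _ = false) //; lia.
by congr (_ *+ nat_of_bool _); lia.
Qed.

Lemma wn_iso r s : (r <= l)%N -> (s <= l)%N -> B (wn r) (wn s) = 0.
Proof.
move=> rl sl; rewrite (wnE wE); [|lia|lia].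
by rewrite (_ : _ == _ = false) //; lia.
Qed.

Lemma vec_iso r s : (0 < r <= l)%N -> (s <= l)%N -> B (vec r) (vec s) = 0.
Proof.
move=> rl sl; rewrite {1}/vec; case: eqP => [r0|_]; first by rewrite r0 in rl.
rewrite /vec; case: eqP => [_|s0]; first by rewrite wv //; lia.
rewrite (wnE wE); [|lia|lia].
by rewrite (_ : _ == _ = false) //; lia.
Qed.

Let lt_lm (r : 'I_l.+1) : (r < m)%N. Proof. by have := ltn_ord r; lia. Qed.
Let std (r : 'I_l.+1) : 'I_m := Ordinal (lt_lm r).

Lemma vec_generic : generic (\matrix_(r, s) B (w (std r)) (vec (s : 'I_l.+1))) != 0.
Proof.
have E (r s : 'I_l.+1) : B (w (std r)) (vec s) =
    (if r == 0 :> nat then B (wn 0) v else 1) *+ (r == s).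
  have rl := ltn_ord r; have sl := ltn_ord s.
  by rewrite -(wn_val w (std r)) wn_vec.
rewrite (_ : \matrix_(r, s) _ = diag_mx (\row_r (if r == 0%N :> nat then B (wn 0) v else 1))).
  rewrite /generic det_diag !mxE eqxx mulr1n mulf_neq0 // prodf_seq_neq0.
  by apply/allP => r _; rewrite mxE; case: ifP => // _; exact: oner_neq0.
by apply/matrixP => r s; rewrite !mxE E.
Qed.

Section FrameVanishing.
Variable la : seq nat.
Hypothesis la_part : is_partition la.
Hypothesis la_size : (size la <= l.+1)%N.

Lemma frames_separate y : y \in so_module B la ->
  (forall b : nat -> W,
     (forall r s, (r <= l)%N -> (s <= l)%N -> B (b r) (b s) = 0) ->
     generic (\matrix_(r < l.+1, s < l.+1) B (b r) (vec s)) != 0 ->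
     ev B y (fun k => b (brow k)) = 0) -> y = 0.
Proof.
move=> yS yv.
have rlt (k : 'I_(sumn la)) : (brow k < l.+1)%N by apply: leq_trans (brow_lt k) la_size.
pose rho k : 'I_l.+1 := Ordinal (rlt k).
apply: (so_module_vanish la_part dimW ndB wE (rho := rho) (vec := fun s => vec s)
  _ m3 lum (std := std) _ vec_generic yS) => // b iso gen.
pose bb (r : nat) := b (inord r).
have bE k : bb (brow k) = b (rho k).
  by rewrite /bb; congr b; apply: val_inj; rewrite /= inordK.
have -> : (fun k => b (rho k)) = (fun k => bb (brow k)).
  by apply: funext => k; rewrite bE.
apply: yv => [r s _ _|]; first exact: iso.
congr (generic _ != 0): gen; apply/matrixP => r s; rewrite !mxE /bb.
by rewrite inord_val.
Qed.

(** Orthogonality to all [omega la b] means that [z] vanishes at all isotropic frames. *)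
Lemma tform_nondegenerate z : z \in so_module B la ->
  (forall y, y \in so_module B la -> tform B y z = 0) -> z = 0.
Proof.
move=> zS z0; apply: frames_separate => // b iso _.
have := z0 (omega la b); rewrite tform_omega // => h.
have /eqP : (#|row_group la| * #|col_group la|)%:R * ev B z (fun k => b (brow k)) = 0.
  by apply: h; apply: omega_in => r s rl sl; apply: iso; rewrite -ltnS (leq_trans _ la_size).
rewrite mulf_eq0 pnatr_eq0 muln_eq0 => /orP[|/eqP //].
have r1 : (1%g : {perm 'I_(sumn la)}) \in row_group la by apply/row_groupP => k; rewrite perm1.
have c1 : (1%g : {perm 'I_(sumn la)}) \in col_group la by apply/col_groupP => k; rewrite perm1.
by rewrite (cardD1 1%g (row_group la)) r1 (cardD1 1%g (col_group la)) c1.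
Qed.

End FrameVanishing.

Lemma prod_lower (la : seq nat) (t : F) :
  \prod_(k < sumn la) (if brow k == 0%N then 1 else t) = t ^+ lower la.
Proof.
rewrite /lower -prodr_const [RHS]big_mkcond; apply: eq_bigr => k _.
by rewrite inE; case: eqP.
Qed.

Theorem not_injective : ~ injective (phi v).
Proof.
move=> inj.
pose L : {linear _ -> F^o} := textend (V := F^o)
  (fun z => \prod_(k < sumn mu) B (z k) (vec (brow k))).
have [x xS xL] := tform_represents L (@tform_nondegenerate mu mu_part mu_size).
have bmu (k : 'I_(sumn mu)) : (brow k <= l)%N.
  by rewrite -ltnS (leq_trans (brow_lt k)).
have bnu (k : 'I_(sumn nu)) : (brow k <= l)%N.
  by rewrite -ltnS (leq_trans (brow_lt k)).
have x0 : x != 0.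
  have omS : omega mu wn \in so_module B mu.
    apply: omega_in => r s rl sl; apply: wn_iso; rewrite -ltnS.
      exact: leq_trans rl mu_size.
    exact: leq_trans sl mu_size.
  have : L (omega mu wn) != 0.
    apply: (@omega_neq0 _ _ B _ mu_part wn vec (fun r => if r == 0%N then B (wn 0) v else 1)).
      move=> r s rl sl; apply: wn_vec; rewrite -ltnS; first exact: leq_trans rl mu_size.
      exact: leq_trans sl mu_size.
    by move=> r; case: ifP => // _; exact: oner_neq0.
  by rewrite -xL //; apply: contraNneq => ->; rewrite tform0r.
pose xs := vsproj (so_module B mu) x.
have xsE : vsval xs = x by exact: vsprojK.
suff y0 : phi v xs = 0.
  have xs0 : xs = 0 by apply: inj; rewrite y0 linear0.
  by move: x0; rewrite -xsE xs0 linear0 eqxx.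
pose y := vsval (phi v xs); have yS : y \in so_module B nu by exact: subvsP.
suff y0 : y = 0 by rewrite -[LHS]vsvalK -/y y0 linear0.
apply: (frames_separate nu_part nu_size yS) => b iso gen.
pose G : 'M[F]_l.+1 := \matrix_(r < l.+1, s < l.+1) B (b r) (vec s).
have [G00 GU] : G 0 0 != 0 /\ G \in unitmx.
  by move: gen; rewrite /generic mulf_eq0 negb_or unitmxE unitfE => /andP[].
(* The basis of the span of the [b r] dual to [vec]; genericity makes the Gram matrix [G]
   invertible. *)
pose d (r : 'I_l.+1) := \sum_(s < l.+1) invmx G r s *: b s.
have dvec r s : B (d r) (vec (s : 'I_l.+1)) = (r == s)%:R.
  rewrite /d sym_suml; transitivity ((invmx G *m G) r s).
    by rewrite mxE; apply: eq_bigr => i _; rewrite symZl [G i s]mxE.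
  by rewrite mulVmx // mxE.
have dd r s : B (d r) (d s) = 0.
  rewrite /d sym_suml big1 // => i _; rewrite symZl sym_sumr big1 ?mulr0 // => j _.
  by rewrite symZr iso ?mulr0 // -ltnS ltn_ord.
have bd (r : 'I_l.+1) : b r = \sum_s G r s *: d s.
  under eq_bigr do rewrite /d scaler_sumr.
  rewrite exchange_big /=; transitivity (\sum_i (G *m invmx G) r i *: b i).
    rewrite mulmxV // (bigD1 r) //= mxE eqxx scale1r big1 ?addr0 // => i ir.
    by rewrite mxE eq_sym (negPf ir) scale0r.
  apply: eq_bigr => i _; rewrite mxE scaler_suml; apply: eq_bigr => s _.
  by rewrite scalerA.
(* These dual isotropic families are both orthogonal to [v] and to [d ord0], so their scalings fix
   these two vectors. *)
pose p (j : 'I_l) := vec j.+1; pose q (j : 'I_l) := d (lift ord0 j).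
have pp i j : B (p i) (p j) = 0.
  exact: (vec_iso (r := i.+1) (s := j.+1) (ltn_ord i) (ltn_ord j)).
have qq i j : B (q i) (q j) = 0 by exact: dd.
have pq i j : B (p i) (q j) = (i == j)%:R.
  by rewrite symC -[p i]/(vec (lift ord0 i)) dvec (inj_eq lift_inj) eq_sym.
have pv i : B (p i) v = 0.
  exact: (vec_iso (r := i.+1) (s := 0) (ltn_ord i) (leq0n l)).
have qv i : B (q i) v = 0 by rewrite (dvec _ ord0).
have pd0 i : B (p i) (d ord0) = 0 by rewrite symC (dvec _ (lift ord0 i)).
have qd0 i : B (q i) (d ord0) = 0 by exact: dd.
(* The multiple of [b 0] that removes the component of [b r] along [d 0], thus making it orthogonal
   to [v]; [G 0 0] is nonzero by genericity. *)
pose c (r : nat) : F := if r == 0%N then 0 else - (G (inord r) 0 / G 0 0).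
pose b' r := b r + c r *: b 0%N.
rewrite -(ev_shear nu_part b yS (erefl : c 0%N = 0)) -/(b' _).
pose z := G 0 0 *: d 0; pose u := \sum_(j < l) G 0 (lift ord0 j) *: q j.
have b0E : b 0%N = z + u by rewrite (bd ord0) big_ord_recl.
have cE (r : 'I_l) : c (lift ord0 r) = - (G (lift ord0 r) 0 / G 0 0).
  have e : inord (lift ord0 r) = lift ord0 r :> 'I_l.+1 by exact: inord_val.
  by rewrite /c e.
have b'E (r : 'I_l) : b' (lift ord0 r) =
    \sum_(j < l) (G (lift ord0 r) (lift ord0 j) + c (lift ord0 r) * G 0 (lift ord0 j)) *: q j.
  rewrite /b' (bd (lift ord0 r)) big_ord_recl b0E /z /u scalerDr scalerA addrACA.
  rewrite -scalerDl [X in X *: _ + _](_ : _ = 0); last by rewrite cE mulNr divfK ?subrr.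
  rewrite scale0r add0r scaler_sumr -big_split; apply: eq_bigr => j _ /=.
  by rewrite scalerDl scalerA.
have b'0 : b' 0%N = z + u by rewrite /b' /c /= scale0r addr0.
(* [N] is the value sought, as a polynomial in the inverse of the scaling
   factor, up to the power coming from the rows below the first one. *)
pose bx (j : 'I_(\dim {:W})) := (vbasis {:W})`_j.
pose N : {poly F} := \sum_K (y K : F)%:P * \prod_k
  (if brow k == 0%N then (B (bx (K k)) z)%:P + (B (bx (K k)) u)%:P * 'X
   else (B (bx (K k)) (b' (brow k)))%:P).
have NE t : N.[t] = ev B y (fun k => if brow k == 0%N then z + t *: u else b' (brow k)).
  rewrite /N evE horner_sum; apply: eq_bigr => K _; rewrite hornerM hornerC horner_prod.
  congr (_ * _); apply: eq_bigr => k _; case: ifP => _; last by rewrite hornerC.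
  rewrite hornerD hornerM !hornerC hornerX symDr mulrC; congr (_ + _).
  exact: (esym (symZr B _ t u)).
have N1 : N.[1] = ev B y (fun k => b' (brow k)).
  rewrite NE; congr ev; apply: funext => k.
  by case: eqP => // ->; rewrite scale1r b'0.
have key t : t != 0 -> N.[1] = t * N.[t].
  (* With [s ^+ 2 = t^-1] the scaling [h] multiplies the [p j] by [t^-1] and the [q j] by [t]. *)
  move=> t0; have [s st] := sqrt_exists t^-1.
  have s0 : s != 0.
    by apply: contraNneq t0 => s0; rewrite -[t]invrK -st s0 expr0n invr0.
  pose h := hscale2 B p q s; pose h' := hscale2 B p q s^-1.
  have hSO : in_SO B h by exact: hscale2_SO.
  have hSO' : in_SO B h' by apply: hscale2_SO => //; rewrite invr_eq0.
  have hv : h v = v by apply: hscale2_fix.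
  have hvec (k : 'I_(sumn mu)) :
      h (vec (brow k)) = (if brow k == 0%N then 1 else t^-1) *: vec (brow k).
    case: (brow k) (bmu k) => [|r] rl; first by rewrite scale1r.
    by rewrite -[vec r.+1]/(p (Ordinal rl)) /h hscale2_p // st.
  (* By nondegeneracy it suffices to pair with members [y1] of the module; invariance moves [h] to
     [y1] as its inverse, and [h] scales the vectors at which [L] evaluates. *)
  have hx : tmap h x = (t^-1) ^+ lower mu *: x.
    apply/eqP; rewrite -subr_eq0; apply/eqP.
    apply: (tform_nondegenerate mu_part mu_size).
      by rewrite rpredB ?rpredZ // tmap_so_module.
    move=> y1 y1S.
    have hK : tmap h (tmap h' y1) = y1.
      by apply: tmapK => k; exact: hscale2K.
    have y1S' := tmap_so_module hSO' y1S.
    rewrite addrC -scaleN1r tform_linr tformZr !xL //.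
    rewrite -{2}hK tform_tmap ?xL //; last exact: (proj1 hSO).
    apply/eqP; rewrite mulN1r addrC subr_eq0; apply/eqP.
    rewrite -[L _]/(ev B (tmap h' y1) (fun k => vec (brow k))).
    rewrite -[L _]/(ev B y1 (fun k => vec (brow k))) -{2}hK.
    rewrite -(ev_tmap _ _ (proj1 hSO)) -prod_lower -ev_scale.
    by congr ev; apply: funext => k; rewrite hvec.
  have hy : tmap h y = (t^-1) ^+ lower mu *: y.
    have := phi_eq hSO v xs; rewrite hv => act.
    rewrite -[LHS](vsprojK (tmap_so_module hSO yS)) -/(so_act h (phi v xs)) -act.
    by rewrite /so_act xsE hx linearZ /= -/xs linearZ.
  have := ev_tmap y (fun k : 'I_(sumn nu) => b' (brow k)) (proj1 hSO).
  rewrite -/h hy evZ N1 => <-.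
  have -> : (fun k : 'I_(sumn nu) => h (b' (brow k))) =
      (fun k => (if brow k == 0%N then 1 else t) *:
         (if brow k == 0%N then z + t *: u else b' (brow k))).
    apply: funext => k; case: (brow k) (bnu k) => [_|r rl] /=.
      rewrite b'0 linearD scale1r /z linearZ /= /h hscale2_fix //; congr (_ + _).
      rewrite /u linear_sum scaler_sumr; apply: eq_bigr => j _.
      by rewrite linearZ /= hscale2_q // -exprVn exprVn st invrK !scalerA mulrC.
    rewrite -[r.+1]/(lift ord0 (Ordinal rl) : nat) b'E linear_sum scaler_sumr.
    apply: eq_bigr => j _; rewrite linearZ /= /h hscale2_q //.
    by rewrite st invrK !scalerA mulrC.
  (* Of the [lower nu] factors [t], all but one cancel against the [lower mu] factors [t^-1]. *)
  rewrite ev_scale prod_lower lower_nu -NE mulrA exprS mulrCA -exprMn mulVf //.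
  by rewrite expr1n mulr1.
rewrite -N1.
(* The relation [N.[1] = t * N.[t]] for nonzero [t] is an identity of polynomials; at [t = 0] it
   gives [N.[1] = 0]. *)
have /(congr1 (fun r : {poly F} => r.[0])) : N.[1]%:P - 'X * N = 0.
  by apply: poly_zero_of_roots => t t0; rewrite !hornerE -key // subrr.
by rewrite hornerD hornerN hornerC hornerM hornerX mul0r subr0 horner0.
Qed.
End NotInjective.

(** * Adding a box to a partition *)

Lemma card_first_row (la : seq nat) :
  (lower la + nth 0%N la 0 = sumn la)%N.
Proof.
case: la => [|a s]; first by apply/eqP; rewrite /lower addn0 cards_eq0; apply/eqP/setP; case.
rewrite /lower /= addnC -[RHS]card_ord -(cardsC [set k : 'I_(sumn (a :: s)) | (k < a)%N]).
have -> : #|[set k : 'I_(sumn (a :: s)) | (k < a)%N]| = a.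
  have le : (a <= sumn (a :: s))%N by exact: leq_addr.
  by rewrite -sum1dep_card (big_ord_narrow le) sum1_card card_ord.
congr (_ + _)%N; apply: eq_card => k; rewrite !inE /brow /reshape_index /=.
by rewrite subn_eq0; case: ltnP.
Qed.

Lemma sumn_nth (la : seq nat) N : (size la <= N)%N ->
  (sumn la = \sum_(r < N) nth 0%N la r)%N.
Proof.
elim: la N => [|a s IHs] N; first by rewrite big1 // => r _; rewrite nth_nil.
by case: N => // N sN; rewrite big_ord_recl /= (IHs N).
Qed.

Section AddsBox.
Variables (mu nu : seq nat) (b : nat * nat).
Hypothesis mu_nu : adds_box mu nu b.

Lemma adds_box_nth r : nth 0%N nu r = (nth 0%N mu r + (r == b.1))%N.
Proof.
case: b mu_nu => i j [/= ij H].
have h c : (c < nth 0 nu r)%N = ((r == i) && (c == j)) || (c < nth 0 mu r)%N.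
  exact: (H (r, c)).
have [ri|ri] /= := eqVneq r i; last first.
  rewrite (negPf ri) /= in h; rewrite addn0; apply/eqP; rewrite eqn_leq.
  by have := h (nth 0%N nu r); have := h (nth 0%N mu r); rewrite !ltnn; lia.
rewrite ri eqxx /= in h *; rewrite /in_diagram /= in ij.
by have := h j; have := h j.+1; have := h (nth 0%N mu i); rewrite eqxx /=; lia.
Qed.

Lemma adds_box_size_gt0 : (0 < size nu)%N.
Proof.
rewrite lt0n; apply/eqP => /size0nil e; have := adds_box_nth b.1.
by rewrite e nth_nil eqxx addn1.
Qed.

Hypothesis mu_part : is_partition mu.

Lemma adds_box_size : (size mu <= size nu)%N.
Proof.
rewrite leqNgt; apply/negP => lt.
have := adds_box_nth (size nu); rewrite nth_default // => /esym/eqP.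
rewrite addn_eq0 => /andP[/eqP z _]; case/andP: mu_part => _ /negP; apply.
by rewrite -z mem_nth.
Qed.

Lemma adds_box_sumn : sumn nu = (sumn mu).+1.
Proof.
have bl : (b.1 < size nu)%N.
  by rewrite ltnNge; apply/negP => h; have := adds_box_nth b.1; rewrite nth_default // eqxx addn1.
rewrite (sumn_nth (leqnn _)) (sumn_nth adds_box_size).
under eq_bigr do rewrite adds_box_nth.
rewrite big_split /= -[RHS]addn1; congr (_ + _)%N.
rewrite (bigD1 (Ordinal bl)) //= eqxx big1 // => r rb.
by rewrite -val_eqE /= in rb; rewrite (negPf rb).
Qed.

Lemma adds_box_lower : b.1 <> 0%N -> lower nu = (lower mu).+1.
Proof.
move=> b0; have := card_first_row nu; have := card_first_row mu.
rewrite adds_box_sumn adds_box_nth; lia.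
Qed.
End AddsBox.

(** * Choice of the basis and conclusion *)

Lemma length_bound_double m la : length_bound m la -> ((size la).+1.*2 <= m)%N.
Proof. by rewrite /length_bound; case: ifP => om; lia. Qed.

Lemma axis_pairing (F : numClosedFieldType) (W : vectType F) (B : {symmetric W})
    (m : nat) (w : 'I_m -> W) (o : 'I_m) (c : F) k :
  (forall a b, B (w a) (w b) = (b == rev_ord a)%:R) -> o = 0%N :> nat -> (k < m)%N ->
  B (wn w k) (c *: (w o + w (rev_ord o))) = c * ((k == m.-1)%:R + (k == 0%N)%:R).
Proof.
move=> wE o0 km; rewrite (wn_val w (Ordinal km)) symZr symDr !wE -!val_eqE /= o0.
by congr (c * ((nat_of_bool _)%:R + (nat_of_bool _)%:R)); clear -km; lia.
Qed.

Local Open Scope complex_scope.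

Theorem proposition24 (R : realType) (m : nat) (W : vectType R[i])
    (dimW : \dim {:W} = m)
    (B : {symmetric W}) (ndB : nondegenerate B)
    (mu nu : seq nat) (mu_part : is_partition mu) (nu_part : is_partition nu)
    (mu_len : length_bound m mu) (nu_len : length_bound m nu)
    (b : nat * nat) (mu_nu : adds_box mu nu b)
    (phi : 'Hom(W, 'Hom(subvs_of (so_module B mu), subvs_of (so_module B nu))))
    (phi_eq : SO_equivariant phi) (phi_neq0 : phi <> 0)
    (v : W) (v_nonisotropic : B v v <> 0) :
  ~ (forall y, exists x, phi v x = y) /\
  (b.1 <> 0%N -> ~ injective (phi v)).
Proof.
have size_nu := length_bound_double nu_len.
have vv : B v v != 0 by apply/eqP.
have [w wE [c c0 vE]] := hyperbolic_basis (F := R[i]) ndB dimW vv.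
have m1 : (0 < m.-1)%N by clear -size_nu; lia.
have m0 : (0 < m)%N by exact: leq_trans m1 (leq_pred m).
pose o : 'I_m := Ordinal m0.
have {}vE : v = c *: (w o + w (rev_ord o)) by apply: vE; rewrite //= subn1.
have wv k : (0 < k < m.-1)%N -> B (wn w k) v = 0.
  move=> /andP[k0 km]; rewrite vE (axis_pairing c wE) //; last first.
    exact: leq_trans km (leq_pred m).
  by rewrite (ltn_eqF km) (gtn_eqF k0) addr0 mulr0.
have w0v : B (wn w 0) v != 0.
  by rewrite vE (axis_pairing c wE) // (ltn_eqF m1) add0r mulr1.
split; first exact: (not_surjective wE ndB nu_part size_nu (adds_box_sumn mu_nu mu_part) phi_eq wv).
move=> b0; have sz0 := adds_box_size_gt0 mu_nu.
(* Frames consist of [l.+1] vectors, one for each row of [nu], so [l] is [(size nu).-1]; the added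
   box makes [size nu] positive. *)
apply: (@not_injective _ _ _ _ _ dimW ndB wE mu nu (size nu).-1 mu_part nu_part) => //.
- by rewrite prednK //; exact: adds_box_size mu_nu mu_part.
- by rewrite prednK.
- by rewrite prednK.
- exact: adds_box_lower mu_nu mu_part b0.
Qed.
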